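(* For all $n\ge0$ the bi-orthogonal polynomials of the deformed Cauchy-Laguerre system satisfy $$x\partial_{x} P_{n}(x) = -(n+a+b+1)P_{n}(x) - \pi_{n}\hat{P}_{n}(x) - \xi s^{a+1}e^{-s}P_{n}(s) K^{0,1}_{n}(x,-s) - \psi t^{b+1}e^{-t}P^{(1)}_{n}(-t) K^{0,0}_{n}(x,t),$$ $$y\partial_{y} Q_{n}(y) = -(n+a+b+1)Q_{n}(y) - \eta_{n}\check{Q}_{n}(y) - \xi s^{a+1}e^{-s}Q^{(1)}_{n}(-s) K^{0,0}_{n}(s,y) - \psi t^{b+1}e^{-t}Q_{n}(t) K^{1,0}_{n}(-t,y),$$ or equivalently \begin{multline*} x\partial_{x} P_{n}(x) = -(n+a+b+1)P_{n}(x) - \pi_{n}\hat{P}_{n}(x)\\ - \xi s^{a+1}e^{-s}\tfrac{P_{n}(s)}{x-s}\Big\{ \big[ \check{Q}^{(1)}_{n}(-s)-1 \big]\hat{P}_{n}(x) + \tfrac{S_{n}}{S_{n+1}} Q^{(1)}_{n+1}(-s)P_{n}(x) + \tfrac{S_{n}}{S_{n+1}} Q^{(1)}_{n}(-s)P_{n+1}(x) \Big\}\\ - \psi t^{b+1}e^{-t}\tfrac{P^{(1)}_{n}(-t)}{x+t}\Big\{ \check{Q}_{n}(t)\hat{P}_{n}(x) + \tfrac{S_{n}}{S_{n+1}} Q_{n+1}(t)P_{n}(x) + \tfrac{S_{n}}{S_{n+1}} Q_{n}(t)P_{n+1}(x) \Big\}, \end{multline*} \begin{multline*} y\partial_{y}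 Q_{n}(y) = -(n+a+b+1)Q_{n}(y) - \eta_{n}\check{Q}_{n}(y)\\ - \xi s^{a+1}e^{-s}\tfrac{Q^{(1)}_{n}(-s)}{s+y}\Big\{ \hat{P}_{n}(s)\check{Q}_{n}(y) + \tfrac{S_{n}}{S_{n+1}}P_{n+1}(s) Q_{n}(y) + \tfrac{S_{n}}{S_{n+1}} P_{n}(s)Q_{n+1}(y) \Big\}\\ - \psi t^{b+1}e^{-t}\tfrac{Q_{n}(t)}{y-t}\Big\{ \big[ \hat{P}^{(1)}_{n}(-t)-1 \big]\check{Q}_{n}(y) + \tfrac{S_{n}}{S_{n+1}} P^{(1)}_{n+1}(-t)Q_{n}(y) + \tfrac{S_{n}}{S_{n+1}} P^{(1)}_{n}(-t)Q_{n+1}(y) \Big\}. \end{multline*}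
   Context: Fix $a,b,\xi,\psi\in\mathbb C$ with $\Re a,\Re b>-1$. For $s,t>0$ put $w_1(x)=(1-\xi\chi_{x>s})x^ae^{-x}$, $w_2(y)=(1-\psi\chi_{y>t})y^be^{-y}$ on $(0,\infty)$, $\langle f,g\rangle=\int_0^\infty\int_0^\infty\frac{w_1(x)w_2(y)}{x+y}f(x)g(y)\,dx\,dy$, $M_{j,k}=\langle x^j,y^k\rangle$, $Z_0=1$, $Z_n=\det(M_{j,k})_{0\le j,k\le n-1}$. $P_n,Q_n$ are polynomials of degree $n$ with the same leading coefficient $S_n$ ($S_n^2=Z_n/Z_{n+1}$) and $\langle P_m,Q_n\rangle=\delta_{m,n}$. $\pi_n=\int_0^\infty w_1P_n\,dx$, $\eta_n=\int_0^\infty w_2Q_n\,dy$. All these depend on $(s,t)$. Standing generic conditions: all $M_{j,k}$ finite (absolutely convergent), $Z_n\ne0$, $\pi_n,\eta_n\ne0$ for all $n\ge0$. For polynomials $P$ in $x$ (including $P_n,\hat P_n$) $P^{(1)}(z)=\int_0^\infty\frac{w_1(x)}{z-x}P(x)\,dx$; for polynomials $Q$ in $y$ (including $Q_n,\check Q_n$) $Q^{(1)}(z)=\int_0^\infty\frac{w_2(y)}{z-y}Q(y)\,dy$. $\hat P_n=-\sum_{k=0}^n\eta_kP_k$, $\check Q_n=-\sum_{j=0}^n\pi_jQ_j$. $K^{0,0}_n(x,y)=\sum_{l=0}^nP_l(x)Q_l(y)$, $K^{0,1}_n(x,y)=\sum_{l=0}^nP_l(x)Q^{(1)}_l(y)$,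 $K^{1,0}_n(x,y)=\sum_{l=0}^nP^{(1)}_l(x)Q_l(y)$. *)

(* Defs.v *)
From HB Require Import structures.
From mathcomp Require Import all_boot all_order all_algebra.
From mathcomp Require Import complex.
From mathcomp Require Import all_classical all_reals all_analysis.

Set Implicit Arguments.
Unset Strict Implicit.
Unset Printing Implicit Defensive.

Import Order.TTheory GRing.Theory Num.Theory.
Import numFieldNormedType.Exports.

Local Open Scope classical_set_scope.
Local Open Scope ring_scope.
Local Open Scope complex_scope.

Definition cintegral d (T : measurableType d) (R : realType)
    (mu : {measure set T -> \bar R}) (D : set T) (f : T -> R[i]) : R[i] :=
  (\int[mu]_(x in D) complex.Re (f x))%R +i* (\int[mu]_(x in D) complex.Im (f x))%R.

Definition cintegrable d (T : measurableType d) (R : realType)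
    (mu : {measure set T -> \bar R}) (D : set T) (f : T -> R[i]) : Prop :=
  mu.-integrable D (fun x => (complex.Re (f x))%:E) /\
  mu.-integrable D (fun x => (complex.Im (f x))%:E).

Section DeformedCauchyLaguerre.
Variable R : realType.
Implicit Types (w : R -> R[i]) (f g p : {poly R[i]}).
Implicit Types (P Q : nat -> {poly R[i]}).

(* x ^ a = exp (a ln x), the principal power; meaningful for x > 0 only *)
Definition cpow (x : R) (a : R[i]) : R[i] :=
  (expR (complex.Re a * ln x))%:C *
  (cos (complex.Im a * ln x) +i* sin (complex.Im a * ln x)).

Definition weight (a xi : R[i]) (s x : R) : R[i] :=
  (1 - xi * (s < x)%R%:R) * cpow x a * (expR (- x))%:C.

Definition half_line : set R := `]0, +oo[.

Definition pairing_integrand w1 w2 f g (z : R * R) : R[i] :=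
  w1 z.1 * w2 z.2 / (z.1 + z.2)%:C * f.[z.1%:C] * g.[z.2%:C].

Definition pairing w1 w2 f g : R[i] :=
  cintegral (lebesgue_measure \x lebesgue_measure)%E (half_line `*` half_line)
    (pairing_integrand w1 w2 f g).

Definition pairing_converges w1 w2 f g : Prop :=
  cintegrable (lebesgue_measure \x lebesgue_measure)%E (half_line `*` half_line)
    (pairing_integrand w1 w2 f g).

Definition bimoment w1 w2 (j k : nat) : R[i] := pairing w1 w2 'X^j 'X^k.

Definition bimoment_det w1 w2 (n : nat) : R[i] :=
  \det (\matrix_(j < n, k < n) bimoment w1 w2 j k).

Definition biorthonormal w1 w2 (S : nat -> R[i]) P Q : Prop :=
  [/\ forall n, size (P n) = n.+1 /\ size (Q n) = n.+1,
      forall n, lead_coef (P n) = S n /\ lead_coef (Q n) = S n,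
      forall n, S n ^+ 2 = bimoment_det w1 w2 n / bimoment_det w1 w2 n.+1
    & forall m n, pairing w1 w2 (P m) (Q n) = (m == n)%:R].

(* pi_n = wmean w1 (P n) and eta_n = wmean w2 (Q n) *)
Definition wmean w p : R[i] :=
  cintegral lebesgue_measure half_line (fun x => w x * p.[x%:C]).

(* p^(1)(z), for z off the half line *)
Definition cauchy_transform w p (z : R[i]) : R[i] :=
  cintegral lebesgue_measure half_line (fun x => w x / (z - x%:C) * p.[x%:C]).

Definition hatP w2 P Q (n : nat) : {poly R[i]} :=
  - \sum_(0 <= k < n.+1) wmean w2 (Q k) *: P k.

Definition checkQ w1 P Q (n : nat) : {poly R[i]} :=
  - \sum_(0 <= j < n.+1) wmean w1 (P j) *: Q j.

Definition K00 P Q (n : nat) (x y : R[i]) : R[i] :=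
  \sum_(0 <= l < n.+1) (P l).[x] * (Q l).[y].

Definition K01 w2 P Q (n : nat) (x y : R[i]) : R[i] :=
  \sum_(0 <= l < n.+1) (P l).[x] * cauchy_transform w2 (Q l) y.

Definition K10 w1 P Q (n : nat) (x y : R[i]) : R[i] :=
  \sum_(0 <= l < n.+1) cauchy_transform w1 (P l) x * (Q l).[y].

End DeformedCauchyLaguerre.

(* Main.v *)
(* The kernel 1/(x+y) is homogeneous of degree -1, so integrating by parts
   against the Euler operators x d/dx and y d/dy gives, for all polynomials f, g,
     (a+b+1) <f,g> + <x f',g> + <f,y g'>
       = (int w1 f) (int w2 g) - c_s f(s) g^(1)(-s) - c_t f^(1)(-t) g(t),
   where c_s = xi s^(a+1) e^(-s) and c_t = psi t^(b+1) e^(-t) come from the jumps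
   of the weights. Expanding x P_n' on P_0, ..., P_n and reading off the
   coefficients <x P_n', Q_k> from this identity gives the first form of the
   relations, since <P_n, y Q_k'> = n delta_{n,k} for k <= n. The second form
   follows from a Christoffel-Darboux formula, itself a consequence of
   <x f,g> + <f,y g> = (int w1 f) (int w2 g). *)

Require Import Defs.
From HB Require Import structures.
From mathcomp Require Import all_boot all_order all_algebra.
From mathcomp Require Import complex ring lra.
From mathcomp Require Import all_classical all_reals all_analysis.
From mathcomp Require Import measurable_realfun.

Set Implicit Arguments.
Unset Strict Implicit.
Unset Printing Implicit Defensive.

Import Order.TTheory GRing.Theory Num.Theory.
Import numFieldNormedType.Exports.

Local Open Scope classical_set_scope.
Local Open Scope ring_scope.
Local Open Scope complex_scope.

(** * Biorthogonal polynomials *)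

(** The hypotheses give convergence of double integrals of monomials only. Finiteness of the moments
    of each single weight is extracted from sections of these double integrals, taken at a point
    before the jump, where the other weight does not vanish.

    Integration by parts is done one variable at a time. For fixed y the primitive is x^(a+j+1)
    e^(-x) / (x+y); Re a > -1 makes it vanish at 0 and the exponential makes it vanish at infinity,
    so the jump leaves the only boundary term. Differentiating the kernel costs x/(x+y)^2 in one
    variable and y/(x+y)^2 in the other; these add up to 1/(x+y), which is why the constant is a+b+1
    and not a+b+2. The exponentials contribute (x+y)/(x+y), whence the product of moments.

    The algebra is done for an abstract bilinear form: the relations for Q_n are those for P_n
    applied to the transposed form, and one Christoffel-Darboux lemma, with an arbitrary functional
    acting on y, covers [K00], [K01] and, transposed, [K10]. *)

Section ScalarForms.
Variable F : fieldType.
Implicit Types (lam : {poly F} -> F) (f g p : {poly F}).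

Lemma scalar0 lam : scalar lam -> lam 0 = 0.
Proof.
by move=> h; have := h (-1) 0 0; rewrite scaler0 addr0 mulN1r addNr.
Qed.

Lemma scalarZ lam : scalar lam -> forall k p, lam (k *: p) = k * lam p.
Proof. by move=> h k p; have := h k p 0; rewrite !addr0 scalar0 ?addr0. Qed.

Lemma scalarD lam : scalar lam -> {morph lam : p q / p + q}.
Proof. by move=> h p q; have := h 1 p q; rewrite scale1r mul1r. Qed.

Lemma scalar_sum lam : scalar lam ->
  forall (I : Type) (r : seq I) (C : pred I) (f : I -> {poly F}),
  lam (\sum_(i <- r | C i) f i) = \sum_(i <- r | C i) lam (f i).
Proof.
by move=> h I r C f; apply: (big_morph lam (scalarD h) (scalar0 h)).
Qed.

Lemma scalar_poly_eq lam lam' : scalar lam -> scalar lam' ->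
  (forall j, lam 'X^j = lam' 'X^j) -> lam =1 lam'.
Proof.
move=> h h' e p; rewrite -[p]coefK poly_def !scalar_sum //.
by apply: eq_bigr => i _; rewrite !scalarZ // e.
Qed.

(** Serves for integrability, which is a predicate rather than an equality of functionals. *)
Lemma poly_linear_closed (C : {poly F} -> Prop) :
  C 0 -> (forall k p q, C p -> C q -> C (k *: p + q)) -> (forall j, C 'X^j) ->
  forall p, C p.
Proof.
move=> C0 Clin CX p; rewrite -[p]coefK poly_def.
by elim/big_rec: _ => // i q _; exact: Clin.
Qed.

Lemma size_sub_scale_lead f g n :
  size g = n.+1 -> (size f <= n.+1)%N ->
  (size (f - (f`_n / lead_coef g) *: g)%R <= n)%N.
Proof.
move=> sg sf; have gn : g`_n = lead_coef g by rewrite lead_coefE sg.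
have g0 : lead_coef g != 0 by rewrite lead_coef_eq0 -size_poly_eq0 sg.
apply/leq_sizeP => j; rewrite leq_eqVlt => /orP[/eqP<-|ltnj].
  by rewrite coefB coefZ gn divfK ?subrr.
rewrite coefB coefZ [f`_j]nth_default ?(leq_trans sf) //.
by rewrite [g`_j]nth_default ?sg // mulr0 subr0.
Qed.

Lemma size_XM_deriv p n : (size p <= n.+1)%N -> (size ('X * p^`())%R <= n.+1)%N.
Proof.
move=> sp; apply/leq_sizeP => -[//|j] nj; rewrite coefXM /= coef_deriv.
by rewrite nth_default ?mul0rn // (leq_trans sp).
Qed.

Lemma size_XM p : (size ('X * p)%R <= (size p).+1)%N.
Proof. by apply: leq_trans (size_polyMleq _ _) _; rewrite size_polyX. Qed.

End ScalarForms.

Section Biorthogonal.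
Variables (F : fieldType) (B : {poly F} -> {poly F} -> F).
Variables (P Q : nat -> {poly F}).
Implicit Types f g p q : {poly F}.
Hypothesis Bl : forall g, scalar (B^~ g).
Hypothesis sizeP : forall n, size (P n) = n.+1.
Hypothesis BPQ : forall m n, B (P m) (Q n) = (m == n)%:R.

(** Since [P k] has degree exactly k, some expansion exists by triangularity; pairing with [Q k]
    then identifies its coefficients. The section rests on linearity in the first argument and the
    degrees of [P], so it applies to [Q] once the arguments of [B] are exchanged. *)
Lemma biorthogonal_expansion n (p : {poly F}) : (size p <= n)%N ->
  p = \sum_(0 <= k < n) B p (Q k) *: P k.
Proof.
move=> sp.
have [c pE] : exists c : nat -> F, p = \sum_(0 <= k < n) c k *: P k.
  elim: n p sp => [|n IHn] p sp.
    exists (fun=> 0); rewrite big_nil; apply/eqP.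
    by rewrite -size_poly_eq0 -leqn0.
  have [c cE] := IHn _ (size_sub_scale_lead (sizeP n) sp).
  (* The top coefficient cancels the term of degree n of [p]; the remainder has size at most n and
     falls under the induction hypothesis. *)
  exists (fun k => if k == n then p`_n / lead_coef (P n) else c k).
  rewrite big_nat_recr //= eqxx; apply/eqP; rewrite -subr_eq cE; apply/eqP.
  by apply: eq_big_nat => k /andP[_ /ltn_eqF ->].
rewrite {1}pE; apply: eq_big_nat => k /andP[_ kn]; congr (_ *: _).
rewrite {1}pE (scalar_sum (Bl _)) big_mkord (bigD1 (Ordinal kn)) //=.
rewrite (scalarZ (Bl _)) BPQ eqxx mulr1 big1 ?addr0 // => i ni.
by rewrite (scalarZ (Bl _)) BPQ (_ : (_ == _) = false) ?mulr0 //; apply/negbTE.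
Qed.

Lemma biorthogonal_low n f : (size f <= n)%N -> B f (Q n) = 0.
Proof.
move=> /biorthogonal_expansion ->; rewrite (scalar_sum (Bl _)) big_nat big1 //.
by move=> k /andP[_ /ltn_eqF kn]; rewrite (scalarZ (Bl _)) BPQ kn mulr0.
Qed.

(** Subtracting the multiple of [P n] with the same coefficient of degree n leaves a polynomial of
    lower degree, which pairs to zero with [Q n]. *)
Lemma biorthogonal_lead n f : (size f <= n.+1)%N ->
  B f (Q n) = f`_n / lead_coef (P n).
Proof.
move=> sf; have /biorthogonal_low := size_sub_scale_lead (sizeP n) sf.
rewrite (scalarD (Bl _)) -scaleNr (scalarZ (Bl _)) BPQ eqxx mulr1.
by move/eqP; rewrite subr_eq0 => /eqP.
Qed.

Lemma biorthogonal_XM n :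
  B ('X * P n) (Q n.+1) = lead_coef (P n) / lead_coef (P n.+1).
Proof.
rewrite biorthogonal_lead; last by apply: leq_trans (size_XM _) _; rewrite sizeP.
by rewrite coefXM /= [lead_coef (P n)]lead_coefE sizeP.
Qed.

Lemma biorthogonal_XM_deriv n : B ('X * (P n)^`()) (Q n) = n%:R.
Proof.
rewrite biorthogonal_lead; last by rewrite size_XM_deriv ?sizeP.
have -> : ('X * (P n)^`())`_n = lead_coef (P n) *+ n.
  by rewrite coefXM lead_coefE sizeP; case: n => [|n] //=; rewrite coef_deriv.
by rewrite mulrnAl divff // lead_coef_eq0 -size_poly_eq0 sizeP.
Qed.

End Biorthogonal.

Section StructureRelations.
Variables (F : fieldType) (B : {poly F} -> {poly F} -> F).
Variables (P Q : nat -> {poly F}) (m1 m2 : {poly F} -> F).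
Implicit Types f g p q : {poly F}.
Hypothesis Bl : forall g, scalar (B^~ g).
Hypothesis Br : forall f, scalar (B f).
Hypothesis sizeP : forall n, size (P n) = n.+1.
Hypothesis sizeQ : forall n, size (Q n) = n.+1.
Hypothesis BPQ : forall m n, B (P m) (Q n) = (m == n)%:R.

Let BQP m n : B (P n) (Q m) = (m == n)%:R.
Proof. by rewrite BPQ eq_sym. Qed.

(** The products [u1 f * u2 g] and [v1 f * v2 g] stand for the two jump terms, each made of a point
    evaluation and a Cauchy transform. Leaving the functionals arbitrary lets the evaluation sit on
    either argument, so both structure relations are instances. *)
Lemma biorthogonal_derivative (kappa : F) (u1 u2 v1 v2 : {poly F} -> F) :
  (forall f g, kappa * B f g + B ('X * f^`()) g + B f ('X * g^`()) =
    m1 f * m2 g - u1 f * u2 g - v1 f * v2 g) ->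
  forall n x, x * (P n)^`().[x] =
    - (n%:R + kappa) * (P n).[x]
    + m1 (P n) * (\sum_(0 <= k < n.+1) m2 (Q k) *: P k).[x]
    - u1 (P n) * (\sum_(0 <= k < n.+1) (P k).[x] * u2 (Q k))
    - v1 (P n) * (\sum_(0 <= k < n.+1) (P k).[x] * v2 (Q k)).
Proof.
move=> E n x; rewrite -{1}(hornerX x) -hornerM.
rewrite {1}(biorthogonal_expansion Bl sizeP BPQ (size_XM_deriv (eq_leq (sizeP n)))).
have coefE k : (k < n.+1)%N -> B ('X * (P n)^`()) (Q k) =
    - (n%:R + kappa) * (n == k)%:R + m1 (P n) * m2 (Q k) - u1 (P n) * u2 (Q k)
    - v1 (P n) * v2 (Q k).
  move=> kn; have := E (P n) (Q k); rewrite BPQ.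
  (* X times the derivative of [Q k] has degree at most k: for k < n it is orthogonal to [P n], and
     for k = n the ratio of leading coefficients is n. *)
  have -> : B (P n) ('X * (Q k)^`()) = n%:R * (n == k)%:R.
    have [->|nk] := eqVneq n k.
      by rewrite (biorthogonal_XM_deriv Br sizeQ (B := fun g f => B f g) BQP) mulr1.
    rewrite (biorthogonal_low Br sizeQ (B := fun g f => B f g) BQP) ?mulr0 //.
    apply: leq_trans (size_XM_deriv (eq_leq (sizeQ k))) _.
    by rewrite ltn_neqAle eq_sym nk -ltnS.
  by move=> /(canRL (addrK _))/(canRL (addKr _)) ->; ring.
rewrite !horner_sum (eq_big_nat _ _ (F2 := fun k =>
  - (n%:R + kappa) * ((n == k)%:R * (P k).[x]) + m1 (P n) * (m2 (Q k) *: P k).[x]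
  - u1 (P n) * ((P k).[x] * u2 (Q k)) - v1 (P n) * ((P k).[x] * v2 (Q k)))); last first.
  by move=> k /andP[_ kn]; rewrite coefE // !hornerZ; ring.
rewrite !big_split /= !sumrN -!mulr_sumr; do 3![congr (_ + _)]; congr (_ * _).
rewrite big_nat_recr //= eqxx mul1r big_nat big1 ?add0r // => k /andP[_ kn].
by rewrite gtn_eqF ?mul0r.
Qed.

(** The functional [lam] acts on the second variable. Evaluation at z has [c = 0]; the Cauchy
    transform at z has [c = 1], because y/(z-y) = z/(z-y) - 1. This defect becomes the -1 inside the
    brackets of the second form. *)
Lemma biorthogonal_Christoffel_Darboux (S : nat -> F) :
  (forall n, lead_coef (P n) = S n /\ lead_coef (Q n) = S n) ->
  (forall f g, B ('X * f) g + B f ('X * g) = m1 f * m2 g) ->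
  forall (lam : {poly F} -> F) (z c : F), scalar lam ->
  (forall q, lam ('X * q) = z * lam q - c * m2 q) ->
  forall n x (hP := - \sum_(0 <= k < n.+1) m2 (Q k) *: P k)
    (cQ := - \sum_(0 <= j < n.+1) m1 (P j) *: Q j),
  (x + z) * (\sum_(0 <= l < n.+1) (P l).[x] * lam (Q l)) =
    (lam cQ - c) * hP.[x] + S n / S n.+1 * lam (Q n.+1) * (P n).[x]
    + S n / S n.+1 * lam (Q n) * (P n.+1).[x].
Proof.
move=> leadPQ D lam z c lamS lamX n x hP cQ.
have leadP m : lead_coef (P m) = S m by have [] := leadPQ m.
have leadQ m : lead_coef (Q m) = S m by have [] := leadPQ m.
(* The matrices of multiplication by x and by y; their sum is the rank-one matrix with entries
   [m1 (P l) * m2 (Q k)]. *)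
pose A l k := B ('X * P l) (Q k); pose A' l k := B (P l) ('X * Q k).
have XP l : (l < n.+1)%N -> x * (P l).[x] = \sum_(0 <= k < n.+2) A l k * (P k).[x].
  move=> ln; rewrite -{1}(hornerX x) -hornerM.
  have sX : (size ('X * P l)%R <= n.+2)%N by rewrite (leq_trans (size_XM _)) ?sizeP.
  rewrite (biorthogonal_expansion Bl sizeP BPQ sX) horner_sum.
  by apply: eq_bigr => k _; rewrite hornerZ.
have XQ k : (k < n.+1)%N ->
    z * lam (Q k) = \sum_(0 <= l < n.+2) A' l k * lam (Q l) + c * m2 (Q k).
  move=> kn; apply/eqP; rewrite -subr_eq -lamX.
  have sX : (size ('X * Q k)%R <= n.+2)%N by rewrite (leq_trans (size_XM _)) ?sizeQ.
  rewrite (biorthogonal_expansion (B := fun g f => B f g) Br sizeQ BQP sX).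
  by rewrite (scalar_sum lamS); apply/eqP/eq_bigr => l _; rewrite (scalarZ lamS).
(* Multiplication raises the degree by one, so a single entry couples the indices up to n with n+1.
   It is the source of the ratio S_n / S_{n+1}. *)
have An l : (l < n.+1)%N -> A l n.+1 = (l == n)%:R * (S n / S n.+1).
  have [->|nl ln] := eqVneq l n.
    by rewrite mul1r /A (biorthogonal_XM Bl sizeP BPQ) !leadP.
  rewrite mul0r /A (biorthogonal_low Bl sizeP BPQ) //.
  by apply: leq_trans (size_XM _) _; rewrite sizeP ltnS ltn_neqAle nl -ltnS.
have A'n l : (l < n.+1)%N -> A' n.+1 l = (l == n)%:R * (S n / S n.+1).
  have [->|nl ln] := eqVneq l n.
    by rewrite mul1r /A' (biorthogonal_XM (B := fun g f => B f g) Br sizeQ BQP) !leadQ.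
  rewrite mul0r /A' (biorthogonal_low (B := fun g f => B f g) Br sizeQ BQP) //.
  by apply: leq_trans (size_XM _) _; rewrite sizeQ ltnS ltn_neqAle nl -ltnS.
have pick (h : nat -> F) :
    \sum_(0 <= l < n.+1) (l == n)%:R * (S n / S n.+1) * h l = S n / S n.+1 * h n.
  rewrite big_nat_recr //= eqxx mul1r big_nat big1 ?add0r // => k /andP[_ kn].
  by rewrite ltn_eqF ?mul0r.
have -> : hP.[x] = - \sum_(0 <= k < n.+1) m2 (Q k) * (P k).[x].
  by rewrite hornerN horner_sum; congr (- _); apply: eq_bigr => k _; rewrite hornerZ.
have -> : lam cQ = - \sum_(0 <= j < n.+1) m1 (P j) * lam (Q j).
  rewrite /cQ -scaleN1r (scalarZ lamS) mulN1r (scalar_sum lamS); congr (- _).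
  by apply: eq_bigr => k _; rewrite (scalarZ lamS).
have leftE : x * \sum_(0 <= l < n.+1) (P l).[x] * lam (Q l) =
    \sum_(0 <= l < n.+1) \sum_(0 <= k < n.+1) A l k * (P k).[x] * lam (Q l)
    + S n / S n.+1 * lam (Q n) * (P n.+1).[x].
  rewrite mulr_sumr (eq_big_nat _ _ (F2 := fun l =>
    \sum_(0 <= k < n.+1) A l k * (P k).[x] * lam (Q l) +
    (l == n)%:R * (S n / S n.+1) * ((P n.+1).[x] * lam (Q l)))).
    by rewrite big_split /= (pick (fun l => _ * lam (Q l))); ring.
  move=> l /andP[_ ln]; rewrite [x * _]mulrA (XP l ln) big_nat_recr //= An // mulrDl.
  by rewrite mulr_suml !mulrA.
have rightE : z * \sum_(0 <= l < n.+1) (P l).[x] * lam (Q l) =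
    \sum_(0 <= l < n.+1) \sum_(0 <= k < n.+1) A' l k * (P k).[x] * lam (Q l)
    + S n / S n.+1 * lam (Q n.+1) * (P n).[x]
    + c * \sum_(0 <= k < n.+1) m2 (Q k) * (P k).[x].
  rewrite [LHS]mulr_sumr (eq_big_nat _ _ (F2 := fun k =>
    \sum_(0 <= l < n.+1) A' l k * (P k).[x] * lam (Q l) +
    (k == n)%:R * (S n / S n.+1) * (lam (Q n.+1) * (P k).[x])
    + c * (m2 (Q k) * (P k).[x]))).
    rewrite !big_split /= (pick (fun l => lam (Q n.+1) * (P l).[x])).
    rewrite exchange_big_nat /= -mulr_sumr. ring.
  move=> k /andP[_ kn]; rewrite mulrCA XQ // big_nat_recr //= A'n // !mulrDr.
  rewrite mulr_sumr; congr (_ + _ + _); [|by ring|by ring].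
  by apply: eq_bigr => l _; ring.
rewrite mulrDl leftE rightE.
(* The square blocks add up to a rank-one double sum, which factorizes. Together with the c-term of
   [rightE] this is [(lam cQ - c) * hP.[x]], the minus signs in [cQ] and [hP] being absorbed. *)
have sumE : \sum_(0 <= l < n.+1) \sum_(0 <= k < n.+1) A l k * (P k).[x] * lam (Q l) +
    \sum_(0 <= l < n.+1) \sum_(0 <= k < n.+1) A' l k * (P k).[x] * lam (Q l) =
    (\sum_(0 <= l < n.+1) m1 (P l) * lam (Q l)) *
    \sum_(0 <= k < n.+1) m2 (Q k) * (P k).[x].
  rewrite -big_split /= mulr_suml; apply: eq_bigr => l _.
  rewrite -big_split /= mulr_sumr; apply: eq_bigr => k _.
  by rewrite -!mulrDl D; ring.
by rewrite (canRL (addrK _) sumE); ring.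
Qed.

End StructureRelations.

(** * Complex-valued integrals *)

Section ComplexIntegral.
Context d (T : measurableType d) (R : realType) (mu : {measure set T -> \bar R}).
Variables (D : set T) (mD : measurable D).
Implicit Types (f g : T -> R[i]) (k : R[i]).

Lemma complex_eq (z w : R[i]) :
  complex.Re z = complex.Re w -> complex.Im z = complex.Im w -> z = w.
Proof. by case: z w => [a b] [c e] /= -> ->. Qed.

Lemma Re_mul (z w : R[i]) : complex.Re (z * w) =
  complex.Re z * complex.Re w - complex.Im z * complex.Im w.
Proof. by case: z w => [a b] [c e]. Qed.

Lemma Im_mul (z w : R[i]) : complex.Im (z * w) =
  complex.Re z * complex.Im w + complex.Im z * complex.Re w.
Proof. by case: z w => [a b] [c e] /=; rewrite addrC; ring. Qed.

Lemma Re_add (z w : R[i]) : complex.Re (z + w) = complex.Re z + complex.Re w.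
Proof. by case: z w => [a b] [c e]. Qed.

Lemma Im_add (z w : R[i]) : complex.Im (z + w) = complex.Im z + complex.Im w.
Proof. by case: z w => [a b] [c e]. Qed.

Lemma eq_cintegral f g : {in D, f =1 g} -> cintegral mu D f = cintegral mu D g.
Proof.
move=> fg; rewrite /cintegral; congr (_ +i* _); apply: eq_Rintegral => x xD.
all: by rewrite fg.
Qed.

Lemma eq_cintegrable f g : {in D, f =1 g} -> cintegrable mu D f -> cintegrable mu D g.
Proof.
by move=> fg [fr fi]; split; [move: fr|move: fi]; apply: eq_integrable => // x xD;
  rewrite fg.
Qed.

Lemma cintegrable_lin k f g : cintegrable mu D f -> cintegrable mu D g ->
  cintegrable mu D (fun x => k * f x + g x).
Proof.
move=> [fr fi] [gr gi]; split.
- apply: (@eq_integrable _ _ _ _ _ mD (fun x => ((complex.Re k)%:E * (complex.Re (f x))%:E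
     - (complex.Im k)%:E * (complex.Im (f x))%:E + (complex.Re (g x))%:E)%E)).
    by move=> x _; rewrite Re_add Re_mul.
  by apply: integrableD => //; apply: integrableB => //; apply: integrableZl.
- apply: (@eq_integrable _ _ _ _ _ mD (fun x => ((complex.Re k)%:E * (complex.Im (f x))%:E
     + (complex.Im k)%:E * (complex.Re (f x))%:E + (complex.Im (g x))%:E)%E)).
    by move=> x _; rewrite Im_add Im_mul.
  by apply: integrableD => //; apply: integrableD => //; apply: integrableZl.
Qed.

Lemma cintegrable0 : cintegrable mu D (fun=> 0).
Proof. by split; exact: integrable0. Qed.

Lemma cintegrableZ k f : cintegrable mu D f -> cintegrable mu D (fun x => k * f x).
Proof.
move=> fi; apply: eq_cintegrable (cintegrable_lin k fi cintegrable0).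
by move=> x _; rewrite addr0.
Qed.

Lemma cintegral_lin k f g : cintegrable mu D f -> cintegrable mu D g ->
  cintegral mu D (fun x => k * f x + g x) = k * cintegral mu D f + cintegral mu D g.
Proof.
move=> [fr fi] [gr gi].
have Z (c : R) (h : T -> R) : mu.-integrable D (EFin \o h) ->
    mu.-integrable D (EFin \o (fun x => c * h x)).
  by move=> hi; apply: eq_integrable (integrableZl mD c hi).
apply: complex_eq; rewrite ?Re_add ?Im_add ?Re_mul ?Im_mul /=.
- under eq_Rintegral do rewrite Re_add Re_mul.
  rewrite RintegralD // ?RintegralB ?RintegralZl //; try exact: Z.
  by apply: eq_integrable (integrableB mD (Z (complex.Re k) _ fr) (Z (complex.Im k) _ fi)).
- under eq_Rintegral do rewrite Im_add Im_mul.
  rewrite RintegralD // ?RintegralD ?RintegralZl //; try exact: Z.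
  by apply: eq_integrable (integrableD mD (Z (complex.Re k) _ fi) (Z (complex.Im k) _ fr)).
Qed.

Lemma cintegral0 : cintegral mu D (fun=> 0) = 0.
Proof.
by rewrite /cintegral /= /Rintegral integral0.
Qed.

Lemma cintegralZ k f : cintegrable mu D f ->
  cintegral mu D (fun x => k * f x) = k * cintegral mu D f.
Proof.
move=> fi; rewrite -[RHS]addr0 -[X in _ + X]cintegral0 -cintegral_lin //.
  by apply: eq_cintegral => x _; rewrite addr0.
exact: cintegrable0.
Qed.

Lemma cintegrableMr_bounded f (h : T -> R) : cintegrable mu D f ->
  measurable_fun D h -> (exists C, forall x, D x -> `|h x| <= C) ->
  cintegrable mu D (fun x => f x * (h x)%:C).
Proof.
move=> [fr fi] mh [C hC].
have bh : [bounded h x | x in D].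
  by exists C; split; [exact: num_real|move=> M CM x Dx; exact: le_trans (hC x Dx) (ltW CM)].
split.
- apply: eq_integrable (integrableMl mD fr mh bh) => // x _.
  by rewrite /= -EFinM Re_mul /= mulr0 subr0.
- apply: eq_integrable (integrableMl mD fi mh bh) => // x _.
  by rewrite /= -EFinM Im_mul /= mulr0 add0r.
Qed.

End ComplexIntegral.

(** Extension by zero from a rectangle is iterated extension by zero; this transfers Fubini from the
    whole product space to [D1] times [D2]. *)
Lemma patch_EFin_setX (R : numDomainType) (T1 T2 : Type) (D1 : set T1) (D2 : set T2)
    (f : T1 * T2 -> R) x y :
  ((EFin \o f) \_ (D1 `*` D2)) (x, y) =
  ((fun y => ((EFin \o (fun x => f (x, y))) \_ D1) x) \_ D2) y.
Proof.
rewrite /patch in_setX /=.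
by case: (x \in D1); case: (y \in D2).
Qed.

Section ComplexFubini.
Context d1 d2 (T1 : measurableType d1) (T2 : measurableType d2) (R : realType).
Variables (m1 : {sigma_finite_measure set T1 -> \bar R}).
Variables (m2 : {sigma_finite_measure set T2 -> \bar R}).
Variables (D1 : set T1) (D2 : set T2).
Hypotheses (mD1 : measurable D1) (mD2 : measurable D2).

Let mD : measurable (D1 `*` D2). Proof. exact: measurableX. Qed.

Lemma integrable_section2 (f : T1 * T2 -> R) :
  (m1 \x m2)%E.-integrable (D1 `*` D2) (EFin \o f) ->
  {ae m2, forall y, D2 y -> m1.-integrable D1 (EFin \o (fun x => f (x, y)))}.
Proof.
move=> /(integrable_mkcond _ mD) /ae_integrable2; apply: filterS => y yi Dy.
apply/(integrable_mkcond _ mD1); apply: eq_integrable yi => // x _.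
by rewrite patch_EFin_setX /patch (mem_set Dy).
Qed.

Lemma integrable_section1 (f : T1 * T2 -> R) :
  (m1 \x m2)%E.-integrable (D1 `*` D2) (EFin \o f) ->
  {ae m1, forall x, D1 x -> m2.-integrable D2 (EFin \o (fun y => f (x, y)))}.
Proof.
move=> /(integrable_mkcond _ mD) /ae_integrable1; apply: filterS => x xi Dx.
apply/(integrable_mkcond _ mD2); apply: eq_integrable xi => // y _.
by rewrite patch_EFin_setX /patch (mem_set Dx).
Qed.

(** A real integral is the [fine] part of an extended one; integrability of every section over [D2]
    makes the inner [fine] lossless at each y. *)
Lemma Rintegral_Fubini2 (f : T1 * T2 -> R) :
  (m1 \x m2)%E.-integrable (D1 `*` D2) (EFin \o f) ->
  (forall y, D2 y -> m1.-integrable D1 (EFin \o (fun x => f (x, y)))) ->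
  \int[(m1 \x m2)%E]_(z in D1 `*` D2) f z =
  \int[m2]_(y in D2) (\int[m1]_(x in D1) f (x, y)).
Proof.
move=> fi si; rewrite /Rintegral; congr fine.
rewrite [LHS]integral_mkcond -integral21_prod_meas1; last first.
  exact/(integrable_mkcond _ mD).
rewrite [RHS]integral_mkcond; apply: eq_integral => y _; rewrite /fubini_G.
under eq_integral do rewrite patch_EFin_setX.
have [yD2|yD2] := boolP (y \in D2); last first.
  rewrite [RHS]/patch (negbTE yD2) integral0_eq // => x _.
  by rewrite /patch (negbTE yD2).
rewrite [RHS]/patch yD2 fineK; last exact: integrable_fin_num (si _ (set_mem yD2)).
by rewrite [RHS]integral_mkcond; apply: eq_integral => x _; rewrite [LHS]/patch yD2.
Qed.

Lemma Rintegral_Fubini1 (f : T1 * T2 -> R) :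
  (m1 \x m2)%E.-integrable (D1 `*` D2) (EFin \o f) ->
  (forall x, D1 x -> m2.-integrable D2 (EFin \o (fun y => f (x, y)))) ->
  \int[(m1 \x m2)%E]_(z in D1 `*` D2) f z =
  \int[m1]_(x in D1) (\int[m2]_(y in D2) f (x, y)).
Proof.
move=> fi si; rewrite /Rintegral; congr fine.
rewrite [LHS]integral_mkcond -integral12_prod_meas1; last first.
  exact/(integrable_mkcond _ mD).
rewrite [RHS]integral_mkcond; apply: eq_integral => x _; rewrite /fubini_F.
under eq_integral do rewrite patch_EFin_setX.
have [xD1|xD1] := boolP (x \in D1); last first.
  rewrite [RHS]/patch (negbTE xD1) integral0_eq // => y _.
  by rewrite /patch (negbTE xD1); case: ifP.
rewrite [RHS]/patch xD1 fineK; last exact: integrable_fin_num (si _ (set_mem xD1)).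
by rewrite [RHS]integral_mkcond; apply: eq_integral => y _; rewrite /patch xD1.
Qed.

Lemma cintegrable_section2 (f : T1 * T2 -> R[i]) :
  cintegrable (m1 \x m2)%E (D1 `*` D2) f ->
  {ae m2, forall y, D2 y -> cintegrable m1 D1 (fun x => f (x, y))}.
Proof.
move=> [/integrable_section2 + /integrable_section2].
by apply: filterS2 => y fr fi Dy; split; [exact: fr|exact: fi].
Qed.

Lemma cintegrable_section1 (f : T1 * T2 -> R[i]) :
  cintegrable (m1 \x m2)%E (D1 `*` D2) f ->
  {ae m1, forall x, D1 x -> cintegrable m2 D2 (fun y => f (x, y))}.
Proof.
move=> [/integrable_section1 + /integrable_section1].
by apply: filterS2 => y fr fi Dy; split; [exact: fr|exact: fi].
Qed.

Lemma cintegral_Fubini2 (f : T1 * T2 -> R[i]) :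
  cintegrable (m1 \x m2)%E (D1 `*` D2) f ->
  (forall y, D2 y -> cintegrable m1 D1 (fun x => f (x, y))) ->
  cintegral (m1 \x m2)%E (D1 `*` D2) f =
  cintegral m2 D2 (fun y => cintegral m1 D1 (fun x => f (x, y))).
Proof.
move=> [fr fi] si; rewrite /cintegral /=; congr (_ +i* _).
- by rewrite (Rintegral_Fubini2 fr) // => y /si[].
- by rewrite (Rintegral_Fubini2 fi) // => y /si[].
Qed.

Lemma cintegral_Fubini1 (f : T1 * T2 -> R[i]) :
  cintegrable (m1 \x m2)%E (D1 `*` D2) f ->
  (forall x, D1 x -> cintegrable m2 D2 (fun y => f (x, y))) ->
  cintegral (m1 \x m2)%E (D1 `*` D2) f =
  cintegral m1 D1 (fun x => cintegral m2 D2 (fun y => f (x, y))).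
Proof.
move=> [fr fi] si; rewrite /cintegral /=; congr (_ +i* _).
- by rewrite (Rintegral_Fubini1 fr) // => y /si[].
- by rewrite (Rintegral_Fubini1 fi) // => y /si[].
Qed.

End ComplexFubini.

(** * The one-variable jump formula *)

Section ComplexPower.
Variable R : realType.
Implicit Types (x y : R) (a c : R[i]).

Lemma Re_cpow x c : complex.Re (cpow x c) =
  expR (complex.Re c * ln x) * cos (complex.Im c * ln x).
Proof. by rewrite /cpow Re_mul /= mul0r subr0. Qed.

Lemma Im_cpow x c : complex.Im (cpow x c) =
  expR (complex.Re c * ln x) * sin (complex.Im c * ln x).
Proof. by rewrite /cpow Im_mul /= mul0r addr0. Qed.

Lemma cpowD x a c : cpow x (a + c) = cpow x a * cpow x c.
Proof.
apply: complex_eq.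
- rewrite [RHS]Re_mul !(Re_cpow, Im_cpow) Re_add Im_add !mulrDl expRD cosD.
  by ring.
- rewrite [RHS]Im_mul !(Re_cpow, Im_cpow) Re_add Im_add !mulrDl expRD sinD.
  by ring.
Qed.

Lemma cpow_nat x n : 0 < x -> cpow x n%:R = x%:C ^+ n.
Proof.
move=> x0; elim: n => [|n IHn].
  by apply: complex_eq; rewrite ?(Re_cpow, Im_cpow) /= !mul0r ?cos0 ?sin0 expR0 ?mulr1 ?mulr0.
rewrite -addn1 natrD cpowD IHn exprD expr1; congr (_ * _).
apply: complex_eq; rewrite ?(Re_cpow, Im_cpow) /= ?mul0r ?mul1r lnK //.
- by rewrite cos0 mulr1.
- by rewrite sin0 mulr0.
Qed.

(** The product rule with c x^(c-1) written as c x^c / x, so that a single power occurs. Real and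
    imaginary parts are treated as separate real functions. *)
Lemma is_derive_cpow_mul c (k : R -> R) (dk x : R) : 0 < x -> is_derive x 1 k dk ->
  is_derive x 1 (fun x => complex.Re (cpow x c * (k x)%:C))
    (complex.Re (c * cpow x c * (k x / x)%:C + cpow x c * dk%:C)) /\
  is_derive x 1 (fun x => complex.Im (cpow x c * (k x)%:C))
    (complex.Im (c * cpow x c * (k x / x)%:C + cpow x c * dk%:C)).
Proof.
move=> x0 kx; have lnx := is_derive1_ln x0.
have e (r : R) : is_derive x 1 (fun x => r * ln x) (r / x).
  apply: is_derive_eq. by rewrite /GRing.scale /=; ring.
split.
- rewrite (_ : (fun x => _) = (fun x => expR (complex.Re c * ln x) *
    cos (complex.Im c * ln x) * k x)); last first.
    by apply/funext => z; rewrite Re_mul Re_cpow /= mulr0 subr0.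
  apply: is_derive_eq.
  move: (Re_cpow x c) (Im_cpow x c); move: (cpow x c) => z zr zi.
  rewrite /GRing.scale /= Re_add !Re_mul /= !Im_mul /= zr zi.
  by ring.
- rewrite (_ : (fun x => _) = (fun x => expR (complex.Re c * ln x) *
    sin (complex.Im c * ln x) * k x)); last first.
    by apply/funext => z; rewrite Im_mul Im_cpow /= mulr0 add0r.
  apply: is_derive_eq.
  move: (Re_cpow x c) (Im_cpow x c); move: (cpow x c) => z zr zi.
  rewrite /GRing.scale /= Im_add !Im_mul /= !Re_mul /= zr zi.
  by ring.
Qed.

End ComplexPower.

(** * Fundamental theorem of calculus and exhaustion of the half line *)

Section ComplexFTC.
Variable R : realType.
Local Notation mu := (@lebesgue_measure R).
Local Notation hl := (@half_line R).
Implicit Types (f g G : R -> R[i]).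

Definition ccontinuous_at f (x : R) :=
  {for x, continuous (fun x => complex.Re (f x))} /\
  {for x, continuous (fun x => complex.Im (f x))}.

Lemma derive_continuous (h : R -> R) (x dh : R) :
  is_derive x 1 h dh -> {for x, continuous h}.
Proof. by move=> [hx _]; exact/differentiable_continuous/derivable1_diffP. Qed.

Lemma ccontinuous_lin (k : R[i]) f g x : ccontinuous_at f x -> ccontinuous_at g x ->
  ccontinuous_at (fun x => k * f x + g x) x.
Proof.
move=> [fr fi] [gr gi]; split.
- rewrite (_ : (fun _ => _) = (fun x => complex.Re k * complex.Re (f x)
      - complex.Im k * complex.Im (f x) + complex.Re (g x))); last first.
    by apply/funext => z; rewrite Re_add Re_mul.
  by apply: cvgD => //; apply: cvgB; apply: cvgM => //; exact: cvg_cst.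
- rewrite (_ : (fun _ => _) = (fun x => complex.Re k * complex.Im (f x)
      + complex.Im k * complex.Re (f x) + complex.Im (g x))); last first.
    by apply/funext => z; rewrite Im_add Im_mul.
  by apply: cvgD => //; apply: cvgD; apply: cvgM => //; exact: cvg_cst.
Qed.

Lemma complex_FTC G g (p q : R) : p < q ->
  (forall x, p <= x <= q ->
    is_derive x 1 (fun x => complex.Re (G x)) (complex.Re (g x)) /\
    is_derive x 1 (fun x => complex.Im (G x)) (complex.Im (g x))) ->
  (forall x, p <= x <= q -> ccontinuous_at g x) ->
  cintegrable mu `[p, q] g /\ cintegral mu `[p, q] g = G q - G p.
Proof.
move=> pq dG cg.
have FTC (H h : R -> R) : (forall x, p <= x <= q -> is_derive x 1 H (h x)) ->
    (forall x, p <= x <= q -> {for x, continuous h}) ->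
    mu.-integrable `[p, q] (EFin \o h) /\ \int[mu]_(x in `[p, q]) h x = H q - H p.
  move=> dH ch.
  have chw : {within `[p, q], continuous h}.
    by apply: continuous_in_subspaceT => x /set_mem /=; rewrite in_itv; exact: ch.
  split.
    by apply: continuous_compact_integrable => //; exact: segment_compact.
  rewrite /Rintegral (continuous_FTC2 pq chw (F := H)) //.
  - have cH x : p <= x <= q -> {for x, continuous H}.
      by move=> /dH /derive_continuous.
    split.
    + move=> x; rewrite in_itv /= => /andP[px xq].
      by have [] : is_derive x 1 H (h x) by apply: dH; rewrite !ltW.
    + by apply: cvg_at_right_filter; apply: cH; rewrite lexx ltW.
    + by apply: cvg_at_left_filter; apply: cH; rewrite lexx ltW.
  - move=> x; rewrite in_itv /= => /andP[px xq]; rewrite derive1E.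
    by have [_ ->] : is_derive x 1 H (h x) by apply: dH; rewrite !ltW.
have [ir er] := FTC _ _ (fun x px => (dG x px).1) (fun x px => (cg x px).1).
have [ii ei] := FTC _ _ (fun x px => (dG x px).2) (fun x px => (cg x px).2).
split=> //; rewrite /cintegral er ei.
by case: (G q) (G p) => [? ?] [? ?].
Qed.

Lemma half_line_measurable : measurable hl.
Proof. exact: measurable_itv. Qed.

(** Dominated convergence with majorant |f|. The compact intervals [1/(n+1), n+1] stay away from 0
    and infinity, so the fundamental theorem applies on each of them. *)
Lemma cvg_Rintegral_half_line (f : R -> R) :
  mu.-integrable hl (EFin \o f) ->
  (\int[mu]_(x in `[n.+1%:R^-1, n.+1%:R]) f x)%R @[n --> \oo] -->
  (\int[mu]_(x in hl) f x)%R.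
Proof.
move=> fi.
pose A n : set R := `[n.+1%:R^-1, n.+1%:R]%classic.
have mA n : measurable (A n) by exact: measurable_itv.
have AD n : A n `<=` hl.
  move=> x; rewrite /A /half_line /= !in_itv /= andbT => /andP[+ _].
  by apply: lt_le_trans; rewrite invr_gt0.
have mf := measurable_int _ fi.
pose F n : R -> \bar R := (EFin \o f) \_ (A n).
have mF n : measurable_fun hl (F n).
  apply/(measurable_restrict _ (mA n) half_line_measurable).
  by apply: measurable_funS mf => //; exact: half_line_measurable.
have lim : {ae mu, forall x, hl x ->
    F ^~ x @ \oo --> (EFin \o f) x}.
  apply: aeW => x; rewrite /half_line /= in_itv /= andbT => x0.
  apply: (@cvg_trans _ ((fun=> (f x)%:E) @ \oo)); last exact: cvg_cst.
  apply: near_eq_cvg; near=> n; rewrite /F patchE mem_set //.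
  rewrite /A /= in_itv /=; apply/andP; split.
    rewrite -[leRHS]invrK lef_pV2 ?posrE ?invr_gt0 //.
    rewrite ltW //; apply: (@lt_trans _ _ n%:R); last by rewrite ltr_nat.
    by near: n; exact: nbhs_infty_gtr.
  rewrite ltW //; apply: (@lt_trans _ _ n%:R); last by rewrite ltr_nat.
  by near: n; exact: nbhs_infty_gtr.
have dom : {ae mu, forall x n, hl x ->
    (`|F n x| <= (abse \o (EFin \o f)) x)%E}.
  apply: aeW => x n _; rewrite /F patchE; case: ifP => // _.
  by rewrite (_ : point = 0%E) // abse0 lee_fin normr_ge0.
have [||_ _] := @dominated_convergence _ _ R mu hl half_line_measurable F (EFin \o f)
  (abse \o (EFin \o f)) mF mf _ (integrable_abse fi) _.
- exact: lim.
- exact: dom.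
have -> : [sequence (\int[mu]_(x in hl) F n x)%E]_n =
    (fun n => \int[mu]_(x in A n) (f x)%:E)%E.
  apply/funext => n /=; rewrite -integral_mkcondr.
  by rewrite (setIidr (@AD n)).
have e : ((\int[mu]_(x in hl) f x)%R)%:E = (\int[mu]_(x in hl) (f x)%:E)%E.
  rewrite fineK //; apply: integrable_fin_num fi; exact: half_line_measurable.
by rewrite -[X in _ --> X]/(\int[mu]_(x in hl) (f x)%:E)%E -e => /fine_cvg.
Unshelve. all: by end_near.
Qed.

End ComplexFTC.

Section WeightFTC.
Variable R : realType.
Local Notation mu := (@lebesgue_measure R).
Local Notation hl := (@half_line R).

Lemma ccontinuous_cpow_mul (c : R[i]) (h : R -> R) x : 0 < x ->
  {for x, continuous h} -> ccontinuous_at (fun x => cpow x c * (h x)%:C) x.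
Proof.
move=> x0 ch.
have [dr di] := is_derive_cpow_mul c x0 (is_derive_cst (1 : R) x 1).
have cr : {for x, continuous (fun x => complex.Re (cpow x c))}.
  rewrite (_ : (fun _ => _) = (fun x => complex.Re (cpow x c * (cst (1 : R) x)%:C))).
    exact: derive_continuous dr.
  by apply/funext => z; rewrite Re_mul /= mulr0 subr0 mulr1.
have ci : {for x, continuous (fun x => complex.Im (cpow x c))}.
  rewrite (_ : (fun _ => _) = (fun x => complex.Im (cpow x c * (cst (1 : R) x)%:C))).
    exact: derive_continuous di.
  by apply/funext => z; rewrite Im_mul /= mulr0 mulr1 add0r.
split.
- rewrite (_ : (fun _ => _) = (fun x => complex.Re (cpow x c) * h x)).
    by apply: cvgM.
  by apply/funext => z; rewrite Re_mul /= mulr0 subr0.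
- rewrite (_ : (fun _ => _) = (fun x => complex.Im (cpow x c) * h x)).
    by apply: cvgM.
  by apply/funext => z; rewrite Im_mul /= mulr0 add0r.
Qed.

Section Kernel.
Variables (c : R[i]) (y : R).
Hypotheses (c0 : 0 < complex.Re c) (y0 : 0 < y).

(** For c = a+j+1 this is x times x^(a+j) e^(-x) / (x+y): the factor x of the Euler operator is
    absorbed into the exponent. *)
Definition euler_primitive (x : R) : R[i] := cpow x c * (expR (- x) / (x + y))%:C.

Definition euler_integrand (x : R) : R[i] :=
  c * (cpow x c * (expR (- x) / (x + y) / x)%:C)
  + cpow x c * (- (expR (- x) / (x + y)) - expR (- x) / (x + y) ^+ 2)%:C.

Lemma euler_FTC (p q : R) : 0 < p -> p < q ->
  cintegrable mu `[p, q] euler_integrand /\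
  cintegral mu `[p, q] euler_integrand = euler_primitive q - euler_primitive p.
Proof.
move=> p0 pq.
have inv_shift (z x : R) : x + z != 0 -> is_derive x 1 (fun x => (x + z)^-1) (- (x + z) ^- 2).
  move=> xz.
  have d1 : is_derive x 1 (fun x => x + z) 1.
    exact: is_derive_shift.
  by have := @is_deriveV _ (fun x => x + z) _ _ _ xz d1; rewrite /GRing.scale /= mulr1.
have D x : p <= x -> 0 < x /\ is_derive x 1 (fun x => (x + y)^-1) (- (x + y) ^- 2).
  move=> px; have x0 := lt_le_trans p0 px; split=> //.
  by apply: inv_shift; rewrite gt_eqF // addr_gt0.
apply: complex_FTC => // x /andP[/D[x0 Dy] _].
  have Dk : is_derive x 1 (fun x => expR (- x) / (x + y))
      (- (expR (- x) / (x + y)) - expR (- x) / (x + y) ^+ 2).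
    by apply: is_derive_eq; rewrite /GRing.scale /=; ring.
  have := is_derive_cpow_mul c x0 Dk.
  by rewrite /euler_integrand mulrA.
(* Continuity of the integrand is deduced from differentiability; [D0] and [Dy] supply the
   derivatives of 1/x and 1/(x+y) to the instance search behind [ex_derive]. *)
have D0 : is_derive x 1 (fun x => x^-1) (- x ^- 2).
  have := @inv_shift 0 x; rewrite addr0 gt_eqF // => /(_ isT).
  by congr (is_derive _ _ _ _); apply/funext => z; rewrite addr0.
apply: ccontinuous_lin; apply: ccontinuous_cpow_mul => //.
  have : derivable (fun x => expR (- x) * (x + y)^-1 * x^-1) x 1 by apply: ex_derive.
  by move=> /derivable1_diffP/differentiable_continuous.
have Dk : derivable (fun x => - (expR (- x) * (x + y)^-1)
    - expR (- x) * ((x + y)^-1 * (x + y)^-1)) x 1 by apply: ex_derive.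
rewrite (_ : (fun _ => _) = (fun x => - (expR (- x) * (x + y)^-1)
   - expR (- x) * ((x + y)^-1 * (x + y)^-1)));
  first exact/differentiable_continuous/derivable1_diffP.
by apply/funext => z; rewrite -exprVn expr2.
Qed.

End Kernel.

End WeightFTC.

Section EulerLimits.
Variables (R : realType) (c : R[i]) (y : R).
Hypotheses (c0 : 0 < complex.Re c) (y0 : 0 < y).

(** The oscillating factor of x^c is a cosine or a sine, and 1/(x+y) <= 1/y; only x^(Re c) e^(-x) is
    left to estimate at the two ends. *)
Lemma euler_primitive_bound (x : R) : 0 < x ->
  `|complex.Re (euler_primitive c y x)| <= expR (complex.Re c * ln x) * expR (- x) / y /\
  `|complex.Im (euler_primitive c y x)| <= expR (complex.Re c * ln x) * expR (- x) / y.
Proof.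
move=> x0; have xy0 : 0 < x + y by rewrite addr_gt0.
have h (u : R) : `|u| <= 1 ->
    `|expR (complex.Re c * ln x) * u * (expR (- x) / (x + y))| <=
    expR (complex.Re c * ln x) * expR (- x) / y.
  move=> u1; rewrite !normrM !(ger0_norm (expR_ge0 _)) normfV (gtr0_norm xy0).
  rewrite -[X in _ <= X]mulrA ler_pM ?mulr_ge0 ?expR_ge0 ?invr_ge0 ?(ltW xy0) //.
    by rewrite ler_piMr ?expR_ge0.
  by rewrite ler_wpM2l ?expR_ge0 // lef_pV2 ?posrE // lerDr ltW.
split.
- rewrite Re_mul Re_cpow /= mulr0 subr0; apply: h; exact: cos_max.
- rewrite Im_mul Im_cpow /= mulr0 add0r; apply: h; exact: sin_max.
Qed.

Lemma cvg0_norm_le (u v : nat -> R) :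
  (forall n, `|u n| <= v n) -> v @ \oo --> 0 -> u @ \oo --> 0.
Proof.
move=> uv v0; apply: (@squeeze_cvgr _ _ _ _ (fun n => - v n) v) => //.
  by apply: nearW => n; rewrite -ler_norml.
by rewrite -oppr0; apply: cvgN.
Qed.

Lemma euler_primitive_cvg0 :
  complex.Re (euler_primitive c y n.+1%:R^-1) @[n --> \oo] --> 0 /\
  complex.Im (euler_primitive c y n.+1%:R^-1) @[n --> \oo] --> 0.
Proof.
(* Near 0 the exponential is bounded by 1, and x^(Re c) tends to 0 because Re c > 0. *)
have v0 : (expR (complex.Re c * ln (n.+1%:R^-1 : R)) / y) @[n --> \oo] --> 0.
  rewrite -[X in _ --> X](mul0r y^-1); apply: cvgM; last exact: cvg_cst.
  have /cvg_at_rightP /(_ harmonic) := powR_cvg0 c0.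
  have h : (forall n, 0 < @harmonic R n) /\ @harmonic R @ \oo --> 0.
    by split; [move=> n; rewrite invr_gt0|exact: cvg_harmonic].
  move=> /(_ h); apply: cvg_trans; apply: near_eq_cvg; apply: nearW => n.
  by rewrite /powR gt_eqF // invr_gt0.
have b n : expR (complex.Re c * ln (n.+1%:R^-1 : R)) * expR (- n.+1%:R^-1) / y <=
    expR (complex.Re c * ln (n.+1%:R^-1 : R)) / y.
  by rewrite ler_pM2r ?invr_gt0 // ler_piMr ?expR_ge0 // -[X in _ <= X]expR0 ler_expR oppr_le0.
have p n : 0 < n.+1%:R^-1 :> R by rewrite invr_gt0.
split; apply: cvg0_norm_le v0 => n.
- exact: le_trans (euler_primitive_bound (p n)).1 (b n).
- exact: le_trans (euler_primitive_bound (p n)).2 (b n).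
Qed.

Lemma euler_primitive_cvgy :
  complex.Re (euler_primitive c y n.+1%:R) @[n --> \oo] --> 0 /\
  complex.Im (euler_primitive c y n.+1%:R) @[n --> \oo] --> 0.
Proof.
(* An integer m >= Re c bounds x^(Re c) by x^m for x >= 1. Since e^x >= x^(m+1) / (m+1)!, it follows
   that x^m e^(-x) <= (m+1)! / x, whence the factorial and the harmonic sequence in the majorant. *)
pose m := Num.bound (complex.Re c).
have cm : complex.Re c <= m%:R by exact/ltW/archi_boundP/ltW.
have v0 : ((m.+1`!%:R / y) * @harmonic R n) @[n --> \oo] --> 0.
  rewrite -[X in _ --> X](mulr0 (m.+1`!%:R / y)); apply: cvgM; first exact: cvg_cst.
  exact: cvg_harmonic.
have b n : expR (complex.Re c * ln (n.+1%:R : R)) * expR (- n.+1%:R) / y <=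
    (m.+1`!%:R / y) * @harmonic R n.
  have n0 : 0 < n.+1%:R :> R by [].
  rewrite [X in _ <= X]mulrAC ler_pM2r ?invr_gt0 // expRN ler_pdivrMr ?expR_gt0 //.
  apply: (@le_trans _ _ (n.+1%:R ^+ m)).
    rewrite -[X in _ <= X]lnK ?posrE ?exprn_gt0 // ler_expR lnXn //.
    by rewrite -[X in _ <= X]mulr_natl ler_wpM2r // ln_ge0 // ler1n.
  rewrite /harmonic /= mulrAC ler_pdivlMr // -exprSr mulrC.
  rewrite -ler_pdivrMr ?ltr0n ?fact_gt0 //.
  by apply: le_trans (expR_ge1Dxn m (ltW n0)); rewrite lerDr.
have p n : 0 < n.+1%:R :> R by [].
split; apply: cvg0_norm_le v0 => n.
- exact: le_trans (euler_primitive_bound (p n)).1 (b n).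
- exact: le_trans (euler_primitive_bound (p n)).2 (b n).
Qed.

End EulerLimits.

Section JumpIntegral.
Variable R : realType.
Local Notation mu := (@lebesgue_measure R).
Local Notation hl := (@half_line R).

Lemma cintegrableS (A D : set R) (f : R -> R[i]) : measurable A -> measurable D ->
  A `<=` D -> cintegrable mu D f -> cintegrable mu A f.
Proof. by move=> mA mD AD [fr fi]; split; [move: fr|move: fi]; apply: integrableS. Qed.

Lemma cintegral_itv_split (f : R -> R[i]) (p s q : R) : p < s -> s < q ->
  cintegrable mu `[p, q] f ->
  cintegral mu `[p, q] f = cintegral mu `[p, s] f + cintegral mu `]s, q] f.
Proof.
move=> ps sq [fr fi].
have split (h : R -> R) : mu.-integrable `[p, q] (EFin \o h) ->
    \int[mu]_(x in `[p, q]) h x =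
    \int[mu]_(x in `[p, s]) h x + \int[mu]_(x in `]s, q]) h x.
  move=> hi; apply/eqP; rewrite addrC -subr_eq; apply/eqP.
  by apply: Rintegral_itvB => //; rewrite bnd_simp ltW.
by rewrite /cintegral (split _ fr) (split _ fi).
Qed.

Lemma cintegral_itv_obnd_cbnd (f : R -> R[i]) (s q : R) :
  cintegrable mu `]s, q] f -> cintegral mu `]s, q] f = cintegral mu `[s, q] f.
Proof. by move=> [fr fi]; rewrite /cintegral !Rintegral_itv_obnd_cbnd. Qed.

(** The factor is 1 up to s and 1 - xi beyond, so the integral is (G s - G p) + (1 - xi) (G q - G
    s). *)
Lemma cintegral_jump_itv (G g : R -> R[i]) (xi : R[i]) (p s q : R) :
  p < s -> s < q ->
  cintegrable mu `[p, q] (fun x : R => (1 - xi * (s < x)%R%:R) * g x) ->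
  (forall u v, p <= u -> u < v ->
    cintegrable mu `[u, v] g /\ cintegral mu `[u, v] g = G v - G u) ->
  cintegral mu `[p, q] (fun x : R => (1 - xi * (s < x)%R%:R) * g x) =
    xi * G s - G p + (1 - xi) * G q.
Proof.
move=> ps sq fi FTC; rewrite (cintegral_itv_split ps sq fi).
have [gi gE] := FTC _ _ (ltW ps) sq.
have g'i : cintegrable mu `]s, q] g.
  apply: cintegrableS gi => //; exact: subset_itv_oc_cc.
rewrite [X in X + _](_ : _ = cintegral mu `[p, s] g); last first.
  apply: eq_cintegral => x; rewrite inE /= in_itv /= => /andP[_ xs].
  by rewrite ltNge xs /= mulr0 subr0 mul1r.
rewrite (FTC _ _ (lexx _) ps).2.
rewrite [X in _ + X](_ : _ = cintegral mu `]s, q] (fun x : R => (1 - xi) * g x)); last first.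
  by apply: eq_cintegral => x; rewrite inE /= in_itv /= => /andP[-> _]; rewrite mulr1.
rewrite cintegralZ // cintegral_itv_obnd_cbnd // gE.
by ring.
Qed.

Lemma cvg_Re_Im_linear (k : R[i]) (u : nat -> R[i]) :
  complex.Re (u n) @[n --> \oo] --> 0 -> complex.Im (u n) @[n --> \oo] --> 0 ->
  complex.Re (k * u n) @[n --> \oo] --> 0 /\ complex.Im (k * u n) @[n --> \oo] --> 0.
Proof.
move=> ur ui; split.
- rewrite (_ : (fun n => _) = (fun n => complex.Re k * complex.Re (u n)
      - complex.Im k * complex.Im (u n))); last by apply/funext => n; rewrite Re_mul.
  rewrite -[X in _ --> X](subr0 (0 : R)) -[X in _ --> X - _](mulr0 (complex.Re k)).
  rewrite -[X in _ --> _ - X](mulr0 (complex.Im k)).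
  by apply: cvgB; apply: cvgM => //; exact: cvg_cst.
- rewrite (_ : (fun n => _) = (fun n => complex.Re k * complex.Im (u n)
      + complex.Im k * complex.Re (u n))); last by apply/funext => n; rewrite Im_mul.
  rewrite -[X in _ --> X](addr0 (0 : R)) -[X in _ --> X + _](mulr0 (complex.Re k)).
  rewrite -[X in _ --> _ + X](mulr0 (complex.Im k)).
  by apply: cvgD; apply: cvgM => //; exact: cvg_cst.
Qed.

(** The integrals over [1/(n+1), n+1] tend to the integral over the half line and also, as the
    primitive vanishes at both ends, to the jump term. Uniqueness of limits is applied to real and
    imaginary parts separately. *)
Lemma euler_jump_integral (c xi : R[i]) (y s : R) :
  0 < complex.Re c -> 0 < y -> 0 < s ->
  cintegrable mu hl (fun x : R => (1 - xi * (s < x)%R%:R) * euler_integrand c y x) ->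
  cintegral mu hl (fun x : R => (1 - xi * (s < x)%R%:R) * euler_integrand c y x) =
    xi * euler_primitive c y s.
Proof.
move=> c0 y0 s0 fi; set f := (fun x => _) in fi *; pose G := euler_primitive c y.
pose p n : R := n.+1%:R^-1; pose q n : R := n.+1%:R.
have p0 n : 0 < p n by rewrite invr_gt0.
have near_eq : \forall n \near \oo,
    xi * G s + (-1 * G (p n) + (1 - xi) * G (q n)) = cintegral mu `[p n, q n] f.
  near=> n.
  have ps : p n < s.
    rewrite -[X in _ < X]invrK ltf_pV2 ?posrE ?invr_gt0 //.
    apply: (@lt_trans _ _ n%:R); last by rewrite ltr_nat.
    by near: n; exact: nbhs_infty_gtr.
  have sq : s < q n.
    apply: (@lt_trans _ _ n%:R); last by rewrite ltr_nat.
    by near: n; exact: nbhs_infty_gtr.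
  rewrite (@cintegral_jump_itv G) //; first by ring.
    apply: cintegrableS fi => //; first exact: half_line_measurable.
    move=> x; rewrite /half_line /= !in_itv /= andbT => /andP[+ _].
    exact: lt_le_trans.
  by move=> u v pu uv; apply: euler_FTC => //; exact: lt_le_trans pu.
have [p0r p0i] := euler_primitive_cvg0 c0 y0.
have [qyr qyi] := euler_primitive_cvgy c0 y0.
have [pr pi] := cvg_Re_Im_linear (-1) p0r p0i.
have [qr qi] := cvg_Re_Im_linear (1 - xi) qyr qyi.
have lim (h : R[i] -> R) (hD : {morph h : z w / z + w}) :
    h (-1 * G (p n)) @[n --> \oo] --> 0 -> h ((1 - xi) * G (q n)) @[n --> \oo] --> 0 ->
    h (cintegral mu `[p n, q n] f) @[n --> \oo] --> h (xi * G s).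
  move=> hp hq.
  have h0 : h (xi * G s) + (h (-1 * G (p n)) + h ((1 - xi) * G (q n)))
      @[n --> \oo] --> h (xi * G s).
    rewrite -[X in _ --> X]addr0; apply: cvgD; first exact: cvg_cst.
    by rewrite -[X in _ --> X](addr0 (0 : R)); exact: cvgD.
  apply: cvg_trans h0; apply: near_eq_cvg; near=> n; rewrite -!hD; congr h.
  by near: n; exact: near_eq.
apply: complex_eq.
- apply: (cvg_unique _ (cvg_Rintegral_half_line fi.1)); first exact: Rhausdorff.
  exact: (lim (@complex.Re R) (@Re_add R) pr qr).
- apply: (cvg_unique _ (cvg_Rintegral_half_line fi.2)); first exact: Rhausdorff.
  exact: (lim (@complex.Im R) (@Im_add R) pi qi).
Unshelve. all: by end_near.
Qed.

End JumpIntegral.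

Section WeightSlice.
Variable R : realType.
Local Notation mu := (@lebesgue_measure R).
Local Notation hl := (@half_line R).

Lemma half_lineP (x : R) : hl x <-> 0 < x.
Proof. by rewrite /half_line /= in_itv /= andbT. Qed.

Lemma measurable_fun_posV d (T : measurableType d) (A : set T) (f : T -> R) :
  measurable A -> measurable_fun A f -> (forall x, A x -> 0 < f x) ->
  measurable_fun A (fun x => (f x)^-1).
Proof.
move=> mA mf f0; apply: (@measurable_comp _ _ _ _ _ _ hl (fun x : R => x^-1) A f) => //.
- exact: half_line_measurable.
- by move=> _ [x Ax <-]; apply/half_lineP/f0.
- apply: open_continuous_measurable_fun; first exact: interval_open.
  move=> x /set_mem /half_lineP x0; apply: inv_continuous; by rewrite gt_eqF.
Qed.

Lemma real_complexV (x : R) : (x^-1)%:C = (x%:C)^-1.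
Proof. exact: (fmorphV (real_complex R)). Qed.

Lemma cpow_neq0 (x : R) (a : R[i]) : cpow x a != 0.
Proof.
have e : cpow x a * cpow x (- a) = 1.
  by rewrite -cpowD subrr; apply: complex_eq;
    rewrite ?Re_cpow ?Im_cpow /= !mul0r expR0 ?cos0 ?sin0 ?mulr1 ?mulr0.
by apply/eqP => h; move: e; rewrite h mul0r => /esym/eqP; rewrite oner_eq0.
Qed.

(** An interval of positive length is not negligible. This selects a point before the jump at which
    sections of the double integrals converge. *)
Lemma ae_exists_itv (t : R) (A : R -> Prop) : 0 < t -> {ae mu, forall y, A y} ->
  exists2 y : R, 0 < y < t & A y.
Proof.
move=> t0 aeA; apply: contrapT => nex.
have neg : mu.-negligible (`]0, t[ : set R).
  apply: negligibleS aeA => y /=; rewrite in_itv /= => y0t Ay.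
  by apply: nex; exists y.
have m0 : mu (`]0, t[ : set R) = 0%E.
  exact: (negligibleP mu (measurable_itv `]0, t[)).1 neg.
by move: m0; rewrite lebesgue_measure_itv /= lte_fin t0 sube0 => -[] /eqP; rewrite gt_eqF.
Qed.

Lemma cintegrable_div_shift (f : R -> R[i]) (y : R) : 0 < y -> cintegrable mu hl f ->
  cintegrable mu hl (fun x => f x / (x + y)%:C).
Proof.
move=> y0 fi; have pos x : hl x -> 0 < x + y by move=> /half_lineP x0; rewrite addr_gt0.
apply: (@eq_cintegrable _ _ _ mu hl _ (fun x : R => f x * ((x + y)^-1)%:C)).
- exact: half_line_measurable.
- by move=> x _; rewrite real_complexV.
apply: cintegrableMr_bounded fi _ _; first exact: half_line_measurable.
  apply: measurable_fun_posV => //; first exact: half_line_measurable.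
  exact: measurable_funD.
exists y^-1 => x hx; rewrite gtr0_norm ?invr_gt0 ?pos //.
by rewrite lef_pV2 ?posrE ?pos // lerDr ltW //; apply/half_lineP.
Qed.

End WeightSlice.

Section WeightEuler.
Variable R : realType.
Local Notation mu := (@lebesgue_measure R).
Local Notation hl := (@half_line R).

Definition mweight (w : R -> R[i]) (j : nat) (x : R) : R[i] := w x * x%:C ^+ j.

(* The x-derivative of x * mweight w j x / (x + y) away from the jump of w,
   computed with x w' = (a - x) w. *)
Definition euler_slice (w : R -> R[i]) (a : R[i]) (j : nat) (y x : R) : R[i] :=
  (a + j%:R + 1) * (mweight w j x / (x + y)%:C) - mweight w j.+1 x / (x + y)%:C
  - mweight w j x / (x + y)%:C * (x / (x + y))%:C.

Lemma cintegrable_euler_slice (w : R -> R[i]) (a : R[i]) (j : nat) (y : R) :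
  0 < y -> (forall j, cintegrable mu hl (mweight w j)) ->
  cintegrable mu hl (euler_slice w a j y).
Proof.
move=> y0 wi; have i0 k := cintegrable_div_shift y0 (wi k).
have i1 : cintegrable mu hl (fun x : R => mweight w j x / (x + y)%:C * (x / (x + y))%:C).
  apply: cintegrableMr_bounded (i0 j) _ _; first exact: half_line_measurable.
    apply: measurable_funM => //; apply: measurable_fun_posV.
    - exact: half_line_measurable.
    - exact: measurable_funD.
    - by move=> x /half_lineP x0; rewrite addr_gt0.
  exists 1 => x /half_lineP x0; rewrite gtr0_norm ?divr_gt0 ?addr_gt0 //.
  by rewrite ler_pdivrMr ?addr_gt0 // mul1r lerDl ltW.
apply: (@eq_cintegrable _ _ _ mu hl _ (fun x : R =>
  (-1) * (mweight w j x / (x + y)%:C * (x / (x + y))%:C)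
  + ((-1) * (mweight w j.+1 x / (x + y)%:C)
     + (a + j%:R + 1) * (mweight w j x / (x + y)%:C)))).
- exact: half_line_measurable.
- by move=> x _; rewrite /euler_slice; ring.
apply: cintegrable_lin => //; first exact: half_line_measurable.
apply: cintegrable_lin => //; first exact: half_line_measurable.
by apply: cintegrableZ => //; exact: half_line_measurable.
Qed.

(** With c = a+j+1 the slice is the jump factor times [euler_integrand], and Re a > -1 makes Re c
    positive even for j = 0. Only the jump term of the primitive remains, with s^(a+j+1) split as
    s^(a+1) s^j. *)
Lemma cintegral_euler_slice (a xi : R[i]) (s : R) (j : nat) (y : R) :
  -1 < complex.Re a -> 0 < s -> 0 < y ->
  (forall j, cintegrable mu hl (mweight (weight a xi s) j)) ->
  cintegral mu hl (euler_slice (weight a xi s) a j y) =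
    xi * cpow s (a + 1) * (expR (- s))%:C * s%:C ^+ j / (s + y)%:C.
Proof.
move=> a1 s0 y0 wi; have ei := cintegrable_euler_slice a j y0 wi.
have cE x : 0 < x -> cpow x (a + j%:R + 1) = cpow x a * x%:C ^+ j * x%:C.
  by move=> x0; rewrite !cpowD -[1 in LHS]/(1%:R) !cpow_nat // expr1.
have pE x : x \in hl -> euler_slice (weight a xi s) a j y x =
    (1 - xi * (s < x)%R%:R) * euler_integrand (a + j%:R + 1) y x.
  move=> /set_mem /half_lineP x0; have x0' : x%:C != 0 :> R[i].
    by rewrite fmorph_eq0 gt_eqF.
  have xy0 : (x%:C + y%:C) != 0 :> R[i].
    by rewrite -rmorphD fmorph_eq0 gt_eqF // addr_gt0.
  rewrite /euler_slice /euler_integrand /mweight /weight cE //.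
  rewrite !(rmorphM, rmorphD, rmorphN, rmorphXn, fmorphV) /= exprS.
  by field; rewrite x0' xy0.
have c0 : 0 < complex.Re (a + j%:R + 1).
  rewrite !Re_add; have -> : complex.Re (j%:R : R[i]) = j%:R.
    by rewrite -[j%:R](rmorph_nat (real_complex R)).
  have : (0 : R) <= j%:R by [].
  by rewrite /=; lra.
have fi : cintegrable mu hl (fun x : R =>
    (1 - xi * (s < x)%R%:R) * euler_integrand (a + j%:R + 1) y x).
  apply: (@eq_cintegrable _ _ _ mu hl _ _ _ pE ei).
  exact: half_line_measurable.
have -> : cintegral mu hl (euler_slice (weight a xi s) a j y) =
    cintegral mu hl (fun x : R =>
      (1 - xi * (s < x)%R%:R) * euler_integrand (a + j%:R + 1) y x).
  exact: eq_cintegral.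
rewrite euler_jump_integral // /euler_primitive cE //.
rewrite cpowD -[1 in RHS]/(1%:R) cpow_nat // expr1.
by rewrite rmorphM /= real_complexV; ring.
Qed.

End WeightEuler.

(** * The Cauchy pairing *)

Section Pairing.
Variable R : realType.
Local Notation mu := (@lebesgue_measure R).
Local Notation hl := (@half_line R).
Implicit Types (w : R -> R[i]) (j k : nat).
Let mhl : measurable hl := @half_line_measurable R.


(** Up to the jump the factor 1 - xi is absent, so this covers xi = 1, where the weight vanishes
    beyond s. *)
Lemma weight_neq0 (a xi : R[i]) (s x : R) : x <= s -> weight a xi s x != 0.
Proof.
move=> xs; rewrite /weight ltNge xs /= mulr0 subr0 mul1r mulf_neq0 ?cpow_neq0 //.
by rewrite (fmorph_eq0 (real_complex R)) gt_eqF ?expR_gt0.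
Qed.

Lemma pairing_integrandXn w1 w2 j k (z : R * R) :
  pairing_integrand w1 w2 'X^j 'X^k z =
  mweight w1 j z.1 * mweight w2 k z.2 / (z.1 + z.2)%:C.
Proof.
rewrite /pairing_integrand /mweight !hornerXn [RHS]mulrAC.
by rewrite -!mulrA; congr (_ * _); ring.
Qed.

Lemma pairing_integrand_mulX w1 w2 j k (x y : R) : 0 < x -> 0 < y ->
  pairing_integrand w1 w2 'X^(j.+1) 'X^k (x, y)
  + pairing_integrand w1 w2 'X^j 'X^(k.+1) (x, y) = mweight w1 j x * mweight w2 k y.
Proof.
move=> x0 y0; have xy : x%:C + y%:C != 0 :> R[i].
  by rewrite -rmorphD fmorph_eq0 gt_eqF // addr_gt0.
rewrite !pairing_integrandXn /mweight /= !exprS rmorphD /=.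
by field.
Qed.

Section Convergent.
Variables (w1 w2 : R -> R[i]) (s t : R).
Hypotheses (s0 : 0 < s) (t0 : 0 < t).
Hypothesis w1s : forall x : R, 0 < x < s -> w1 x != 0.
Hypothesis w2t : forall y : R, 0 < y < t -> w2 y != 0.
Hypothesis conv : forall j k, pairing_converges w1 w2 'X^j 'X^k.

(* Almost every section of the convergent double integrals converges; multiplying
   one at a point where w2 does not vanish by x + y removes the kernel. *)
Lemma cintegrable_mweight1 j : cintegrable mu hl (mweight w1 j).
Proof.
have [y /andP[y0 yt] [fS f]] := ae_exists_itv t0 (filterI
  (@cintegrable_section2 _ _ _ _ R mu mu hl hl mhl mhl _ (conv j.+1 0))
  (@cintegrable_section2 _ _ _ _ R mu mu hl hl mhl mhl _ (conv j 0))).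
have hy : hl y by apply/half_lineP.
have w2y : w2 y != 0 by rewrite w2t ?y0.
apply: (@eq_cintegrable _ _ _ mu hl _ (fun x : R => (w2 y)^-1 *
    (y%:C * pairing_integrand w1 w2 'X^j 'X^0 (x, y)
     + pairing_integrand w1 w2 'X^(j.+1) 'X^0 (x, y)))).
- exact: half_line_measurable.
- move=> x /set_mem /half_lineP x0; have xy : x%:C + y%:C != 0 :> R[i].
    by rewrite -rmorphD fmorph_eq0 gt_eqF // addr_gt0.
  rewrite !pairing_integrandXn /mweight /= !exprS rmorphD /=.
  by field; rewrite xy w2y.
apply: cintegrableZ; first exact: half_line_measurable.
by apply: cintegrable_lin; [exact: half_line_measurable|exact: f|exact: fS].
Qed.

Lemma cintegrable_mweight2 k : cintegrable mu hl (mweight w2 k).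
Proof.
have [x /andP[x0 xs] [fS f]] := ae_exists_itv s0 (filterI
  (@cintegrable_section1 _ _ _ _ R mu mu hl hl mhl mhl _ (conv 0 k.+1))
  (@cintegrable_section1 _ _ _ _ R mu mu hl hl mhl mhl _ (conv 0 k))).
have hx : hl x by apply/half_lineP.
have w1x : w1 x != 0 by rewrite w1s ?x0.
apply: (@eq_cintegrable _ _ _ mu hl _ (fun y : R => (w1 x)^-1 *
    (x%:C * pairing_integrand w1 w2 'X^0 'X^k (x, y)
     + pairing_integrand w1 w2 'X^0 'X^(k.+1) (x, y)))).
- exact: half_line_measurable.
- move=> y /set_mem /half_lineP y0; have xy : x%:C + y%:C != 0 :> R[i].
    by rewrite -rmorphD fmorph_eq0 gt_eqF // addr_gt0.
  rewrite !pairing_integrandXn /mweight /= !exprS rmorphD /=.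
  by field; rewrite xy w1x.
apply: cintegrableZ; first exact: half_line_measurable.
by apply: cintegrable_lin; [exact: half_line_measurable|exact: f|exact: fS].
Qed.

Lemma cintegral_wmean_Xn w j : wmean w 'X^j = cintegral mu hl (mweight w j).
Proof. by apply: eq_cintegral => x _; rewrite hornerXn. Qed.

(* Multiplying the kernel 1/(x+y) by x + y factorizes the double integral. *)
Lemma pairing_mulX j k :
  pairing w1 w2 'X^(j.+1) 'X^k + pairing w1 w2 'X^j 'X^(k.+1) =
  wmean w1 'X^j * wmean w2 'X^k.
Proof.
pose f (z : R * R) := 1 * pairing_integrand w1 w2 'X^(j.+1) 'X^k z
  + pairing_integrand w1 w2 'X^j 'X^(k.+1) z.
have fE x y : hl x -> hl y -> f (x, y) = mweight w2 k y * mweight w1 j x.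
  move=> /half_lineP x0 /half_lineP y0.
  by rewrite /f mul1r pairing_integrand_mulX // mulrC.
have fi : cintegrable (mu \x mu)%E (hl `*` hl) f.
  by apply: cintegrable_lin; [exact: measurableX|exact: conv|exact: conv].
have -> : pairing w1 w2 'X^(j.+1) 'X^k + pairing w1 w2 'X^j 'X^(k.+1) =
    cintegral (mu \x mu)%E (hl `*` hl) f.
  rewrite cintegral_lin; [by rewrite mul1r|exact: measurableX|exact: conv|exact: conv].
rewrite (@cintegral_Fubini2 _ _ _ _ R mu mu hl hl mhl mhl f).
- rewrite !cintegral_wmean_Xn -cintegralZ; last exact: cintegrable_mweight2.
    apply: eq_cintegral => y /set_mem hy.
    rewrite mulrC -cintegralZ; last exact: cintegrable_mweight1.
      by apply: eq_cintegral => x /set_mem hx; exact: fE.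
    exact: half_line_measurable.
  exact: half_line_measurable.
- exact: fi.
- move=> y hy; apply: (@eq_cintegrable _ _ _ mu hl _ (fun x : R => mweight w2 k y * mweight w1 j x)).
  + exact: half_line_measurable.
  + by move=> x /set_mem hx; rewrite fE.
  + apply: cintegrableZ; first exact: half_line_measurable.
    exact: cintegrable_mweight1.
Qed.

End Convergent.

End Pairing.

(** * The Euler identity on monomials *)

Section PairingEuler.
Variable R : realType.
Local Notation mu := (@lebesgue_measure R).
Local Notation hl := (@half_line R).
Let mhl : measurable hl := @half_line_measurable R.
Let mhl2 : measurable (hl `*` hl). Proof. exact: measurableX. Qed.

Variables (a b xi psi : R[i]) (s t : R).
Hypotheses (ha : -1 < complex.Re a) (hb : -1 < complex.Re b).
Hypotheses (s0 : 0 < s) (t0 : 0 < t).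
Let w1 := weight a xi s.
Let w2 := weight b psi t.
Hypothesis conv : forall j k : nat, pairing_converges w1 w2 'X^j 'X^k.

Lemma cintegrable_weight1 j : cintegrable mu hl (mweight w1 j).
Proof.
apply: (cintegrable_mweight1 t0 _ conv) => y /andP[_ yt].
by rewrite weight_neq0 // ltW.
Qed.

Lemma cintegrable_weight2 k : cintegrable mu hl (mweight w2 k).
Proof.
apply: (cintegrable_mweight2 s0 _ conv) => y /andP[_ yt].
by rewrite weight_neq0 // ltW.
Qed.

Let i1 := cintegrable_weight1.
Let i2 := cintegrable_weight2.

(** Differentiating the kernel produces an extra factor x/(x+y) or y/(x+y); both lie between 0 and
    1, so convergence of the original double integral is inherited. *)
Let ratio_integrable (j k : nat) (h : R * R -> R) :
  measurable_fun setT h -> (forall z, (hl `*` hl) z -> 0 < h z <= z.1 + z.2) ->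
  cintegrable (mu \x mu)%E (hl `*` hl)
    (fun z => pairing_integrand w1 w2 'X^j 'X^k z * (h z / (z.1 + z.2))%:C).
Proof.
move=> mh hb'; apply: cintegrableMr_bounded (conv j k) _ _ => //.
  apply: measurable_funM; first exact: measurable_funTS.
  apply: measurable_fun_posV => //.
    by apply: measurable_funTS; apply: measurable_funD;
      [exact: measurable_fst|exact: measurable_snd].
  by move=> z [/half_lineP z1 /half_lineP z2]; rewrite addr_gt0.
exists 1 => z [hz1 hz2]; have /andP[h0 hle] := hb' z (conj hz1 hz2).
have z0 : 0 < z.1 + z.2 by apply: lt_le_trans hle.
by rewrite gtr0_norm ?divr_gt0 // ler_pdivrMr // mul1r.
Qed.

(** [H1] comes from differentiation in x at fixed y, [H2] from the reverse. Each contains the square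
    of the kernel, which disappears only in their sum. *)
Let H1 (j k : nat) (z : R * R) := mweight w2 k z.2 * euler_slice w1 a j z.2 z.1.
Let H2 (j k : nat) (z : R * R) := mweight w1 j z.1 * euler_slice w2 b k z.1 z.2.

Let H1i j k : cintegrable (mu \x mu)%E (hl `*` hl) (H1 j k).
Proof.
apply: (@eq_cintegrable _ _ _ (mu \x mu)%E (hl `*` hl) _ (fun z : R * R =>
    (-1) * (pairing_integrand w1 w2 'X^j 'X^k z * (z.1 / (z.1 + z.2))%:C)
    + ((-1) * pairing_integrand w1 w2 'X^(j.+1) 'X^k z
    + (a + j%:R + 1) * pairing_integrand w1 w2 'X^j 'X^k z))) => //.
- by move=> z _; rewrite !pairing_integrandXn /H1 /euler_slice; ring.
- apply: cintegrable_lin => //.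
    apply: ratio_integrable; first exact: measurable_fst.
    by move=> z [/half_lineP z1 /half_lineP z2]; rewrite z1 lerDl ltW.
  by apply: cintegrable_lin => //; [exact: conv|apply: cintegrableZ => //; exact: conv].
Qed.

Let H2i j k : cintegrable (mu \x mu)%E (hl `*` hl) (H2 j k).
Proof.
apply: (@eq_cintegrable _ _ _ (mu \x mu)%E (hl `*` hl) _ (fun z : R * R =>
    (-1) * (pairing_integrand w1 w2 'X^j 'X^k z * (z.2 / (z.1 + z.2))%:C)
    + ((-1) * pairing_integrand w1 w2 'X^j 'X^(k.+1) z
    + (b + k%:R + 1) * pairing_integrand w1 w2 'X^j 'X^k z))) => //.
- move=> z _; rewrite !pairing_integrandXn /H2 /euler_slice.
  by rewrite [z.2 + z.1]addrC; ring.
- apply: cintegrable_lin => //.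
    apply: ratio_integrable; first exact: measurable_snd.
    by move=> z [/half_lineP z1 /half_lineP z2]; rewrite z2 lerDr ltW.
  by apply: cintegrable_lin => //; [exact: conv|apply: cintegrableZ => //; exact: conv].
Qed.

Lemma cauchy_transformXn w (j : nat) (r : R) : 0 < r ->
  (forall j, cintegrable mu hl (mweight w j)) ->
  cauchy_transform w 'X^j (- r%:C) =
  - cintegral mu hl (fun x : R => mweight w j x / (x + r)%:C).
Proof.
move=> r0 wi; rewrite -[RHS]mulN1r -cintegralZ //; last exact: cintegrable_div_shift.
apply: eq_cintegral => x _; rewrite hornerXn /mweight.
by rewrite -opprD -rmorphD invrN [r + x]addrC; ring.
Qed.

(** Integrating over x first, each slice leaves its jump term at s; the factor 1/(s+y) integrated
    against [w2] is minus the Cauchy transform at -s, hence the sign. *)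
Let H1E j k : cintegral (mu \x mu)%E (hl `*` hl) (H1 j k) =
  - (xi * cpow s (a + 1) * (expR (- s))%:C * s%:C ^+ j *
     cauchy_transform w2 'X^k (- s%:C)).
Proof.
rewrite (@cintegral_Fubini2 _ _ _ _ R mu mu hl hl mhl mhl (H1 j k)) //; last first.
  move=> y /half_lineP y0; rewrite /H1 /=; apply: cintegrableZ => //.
  exact: cintegrable_euler_slice.
rewrite cauchy_transformXn // mulrN opprK -cintegralZ //; last exact: cintegrable_div_shift.
apply: eq_cintegral => y /set_mem /half_lineP y0.
rewrite /H1 /= cintegralZ //; last exact: cintegrable_euler_slice.
by rewrite cintegral_euler_slice // [s + y]addrC; ring.
Qed.

Let H2E j k : cintegral (mu \x mu)%E (hl `*` hl) (H2 j k) =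
  - (psi * cpow t (b + 1) * (expR (- t))%:C * t%:C ^+ k *
     cauchy_transform w1 'X^j (- t%:C)).
Proof.
rewrite (@cintegral_Fubini1 _ _ _ _ R mu mu hl hl mhl mhl (H2 j k)) //; last first.
  move=> x /half_lineP x0; rewrite /H2 /=; apply: cintegrableZ => //.
  exact: cintegrable_euler_slice.
rewrite cauchy_transformXn // mulrN opprK -cintegralZ //; last exact: cintegrable_div_shift.
apply: eq_cintegral => x /set_mem /half_lineP x0.
rewrite /H2 /= cintegralZ //; last exact: cintegrable_euler_slice.
by rewrite cintegral_euler_slice // [t + x]addrC; ring.
Qed.

Lemma pairing_euler j k :
  (a + b + 1 + j%:R + k%:R) * pairing w1 w2 'X^j 'X^k =
  wmean w1 'X^j * wmean w2 'X^k
  - xi * cpow s (a + 1) * (expR (- s))%:C * s%:C ^+ j *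
    cauchy_transform w2 'X^k (- s%:C)
  - psi * cpow t (b + 1) * (expR (- t))%:C * t%:C ^+ k *
    cauchy_transform w1 'X^j (- t%:C).
Proof.
(* The coefficient is (a+j+1) + (b+k+1) - 1, where the -1 is minus the sum of x/(x+y) and y/(x+y);
   the exponentials give the two shifted pairings. *)
have sumE : cintegral (mu \x mu)%E (hl `*` hl) (H1 j k)
    + cintegral (mu \x mu)%E (hl `*` hl) (H2 j k) =
    (a + b + 1 + j%:R + k%:R) * pairing w1 w2 'X^j 'X^k
    - (pairing w1 w2 'X^(j.+1) 'X^k + pairing w1 w2 'X^j 'X^(k.+1)).
  rewrite -[X in X + _]mul1r -cintegral_lin //.
  have -> : (a + b + 1 + j%:R + k%:R) * pairing w1 w2 'X^j 'X^k
      - (pairing w1 w2 'X^(j.+1) 'X^k + pairing w1 w2 'X^j 'X^(k.+1)) =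
      (-1) * pairing w1 w2 'X^(j.+1) 'X^k + ((-1) * pairing w1 w2 'X^j 'X^(k.+1)
      + (a + b + 1 + j%:R + k%:R) * pairing w1 w2 'X^j 'X^k) by ring.
  rewrite -[X in _ = _ + (_ + X)]cintegralZ //; last exact: conv.
  rewrite -[X in _ = _ + X]cintegral_lin //; last 2 first.
  - exact: conv.
  - by apply: cintegrableZ => //; exact: conv.
  rewrite -cintegral_lin //; last 2 first.
  - exact: conv.
  - by apply: cintegrable_lin => //; [exact: conv|apply: cintegrableZ => //; exact: conv].
  apply: eq_cintegral => z /set_mem [/half_lineP z1 /half_lineP z2].
  have z0 : z.1%:C + z.2%:C != 0 :> R[i].
    by rewrite -rmorphD fmorph_eq0 gt_eqF // addr_gt0.
  rewrite !pairing_integrandXn /H1 /H2 /euler_slice [z.2 + z.1]addrC.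
  rewrite !(rmorphM, fmorphV) /= rmorphD /=; field.
  by rewrite z0.
rewrite (pairing_mulX s0 t0) // in sumE; last 2 first.
- by move=> x /andP[_ xs]; rewrite weight_neq0 // ltW.
- by move=> x /andP[_ xs]; rewrite weight_neq0 // ltW.
move: sumE; rewrite H1E H2E => /eqP; rewrite eq_sym subr_eq => /eqP ->.
by ring.
Qed.

End PairingEuler.

(** * Linear extension from monomials to polynomials *)

Section PolynomialFunctionals.
Variable R : realType.
Local Notation mu := (@lebesgue_measure R).
Local Notation hl := (@half_line R).
Let mhl : measurable hl := @half_line_measurable R.
Let mhl2 : measurable (hl `*` hl). Proof. exact: measurableX. Qed.
Implicit Types (w : R -> R[i]) (f g p q : {poly R[i]}).

Lemma pairing_integrand_linl w1 w2 k f g h (z : R * R) :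
  pairing_integrand w1 w2 (k *: f + g) h z =
  k * pairing_integrand w1 w2 f h z + pairing_integrand w1 w2 g h z.
Proof. by rewrite /pairing_integrand hornerD hornerZ; ring. Qed.

Lemma pairing_integrand_linr w1 w2 k f g h (z : R * R) :
  pairing_integrand w1 w2 h (k *: f + g) z =
  k * pairing_integrand w1 w2 h f z + pairing_integrand w1 w2 h g z.
Proof. by rewrite /pairing_integrand hornerD hornerZ; ring. Qed.

Section Pairing.
Variables w1 w2 : R -> R[i].
Hypothesis conv : forall j k : nat, pairing_converges w1 w2 'X^j 'X^k.

Lemma pairing_converges_poly f g : pairing_converges w1 w2 f g.
Proof.
move: f; apply: poly_linear_closed => [|k p q pi qi|j].
- apply: (@eq_cintegrable _ _ _ (mu \x mu)%E (hl `*` hl) mhl2 _ _ _ (cintegrable0 _ _)) => z _.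
  by rewrite /pairing_integrand horner0 mulr0 mul0r.
- apply: (@eq_cintegrable _ _ _ (mu \x mu)%E (hl `*` hl) _ (fun z : R * R =>
    k * pairing_integrand w1 w2 p g z + pairing_integrand w1 w2 q g z)) => //.
  + by move=> z _; rewrite pairing_integrand_linl.
  + exact: cintegrable_lin.
move: g; apply: poly_linear_closed => [|k p q pi qi|k].
- apply: (@eq_cintegrable _ _ _ (mu \x mu)%E (hl `*` hl) mhl2 _ _ _ (cintegrable0 _ _)) => z _.
  by rewrite /pairing_integrand horner0 mulr0.
- apply: (@eq_cintegrable _ _ _ (mu \x mu)%E (hl `*` hl) _ (fun z : R * R =>
    k * pairing_integrand w1 w2 'X^j p z
    + pairing_integrand w1 w2 'X^j q z)) => //.
  + by move=> z _; rewrite pairing_integrand_linr.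
  + exact: cintegrable_lin.
- exact: conv.
Qed.

Lemma pairing_scalarl g : scalar (pairing w1 w2 ^~ g).
Proof.
move=> k p q; rewrite -cintegral_lin //; [|exact: pairing_converges_poly..].
by apply: eq_cintegral => z _; rewrite pairing_integrand_linl.
Qed.

Lemma pairing_scalarr f : scalar (pairing w1 w2 f).
Proof.
move=> k p q; rewrite -cintegral_lin //; [|exact: pairing_converges_poly..].
by apply: eq_cintegral => z _; rewrite pairing_integrand_linr.
Qed.

End Pairing.

Section Moments.
Variable w : R -> R[i].
Hypothesis wi : forall j, cintegrable mu hl (mweight w j).

Lemma cintegrable_poly p : cintegrable mu hl (fun x : R => w x * p.[x%:C]).
Proof.
move: p; apply: poly_linear_closed => [|k p q pi qi|j].
- apply: (@eq_cintegrable _ _ _ mu hl _ _ _ _ (cintegrable0 _ _)) => // x _.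
  by rewrite horner0 mulr0.
- apply: (@eq_cintegrable _ _ _ mu hl _ (fun x : R =>
    k * (w x * p.[x%:C]) + w x * q.[x%:C])) => //.
  + by move=> x _; rewrite hornerD hornerZ; ring.
  + exact: cintegrable_lin.
- apply: (@eq_cintegrable _ _ _ mu hl _ _ _ _ (wi j)) => // x _.
  by rewrite hornerXn.
Qed.

Lemma cintegrable_cauchy p (r : R) : 0 < r ->
  cintegrable mu hl (fun x : R => w x / (- r%:C - x%:C) * p.[x%:C]).
Proof.
move=> r0; apply: (@eq_cintegrable _ _ _ mu hl _ (fun x : R =>
  (-1) * (w x * p.[x%:C] / (x + r)%:C))) => //; last first.
  by apply: cintegrableZ => //; apply: cintegrable_div_shift => //; exact: cintegrable_poly.
by move=> x _; rewrite -opprD -rmorphD invrN [r + x]addrC; ring.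
Qed.

Lemma wmean_scalar : scalar (wmean w).
Proof.
move=> k p q; rewrite -cintegral_lin //; [|exact: cintegrable_poly..].
by apply: eq_cintegral => x _; rewrite hornerD hornerZ; ring.
Qed.

Lemma cauchy_transform_scalar (r : R) : 0 < r ->
  scalar (cauchy_transform w ^~ (- r%:C)).
Proof.
move=> r0 k p q; rewrite -cintegral_lin //; [|exact: cintegrable_cauchy..].
by apply: eq_cintegral => x _; rewrite hornerD hornerZ; ring.
Qed.

(** From x/(z-x) = z/(z-x) - 1 at z = -r. The literal [1 *] matches the constant [c] of
    [biorthogonal_Christoffel_Darboux]. *)
Lemma cauchy_transform_mulX (r : R) p : 0 < r ->
  cauchy_transform w ('X * p) (- r%:C) =
  - r%:C * cauchy_transform w p (- r%:C) - 1 * wmean w p.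
Proof.
move=> r0; rewrite mul1r -[X in _ = _ + X]mulN1r addrC.
rewrite -[X in _ = _ + X]cintegralZ //; last exact: cintegrable_cauchy.
rewrite -cintegral_lin //; last 2 first.
- exact: cintegrable_poly.
- by apply: cintegrableZ => //; exact: cintegrable_cauchy.
apply: eq_cintegral => x /set_mem /half_lineP x0.
have rx : - r%:C - x%:C != 0 :> R[i].
  by rewrite -opprD oppr_eq0 -rmorphD fmorph_eq0 gt_eqF // addr_gt0.
by rewrite hornerM hornerX; field.
Qed.

End Moments.

End PolynomialFunctionals.

Section BilinearIdentities.
Variable R : realType.
Local Notation mu := (@lebesgue_measure R).
Local Notation hl := (@half_line R).
Variables (a b xi psi : R[i]) (s t : R).
Hypotheses (ha : -1 < complex.Re a) (hb : -1 < complex.Re b).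
Hypotheses (s0 : 0 < s) (t0 : 0 < t).
Let w1 := weight a xi s.
Let w2 := weight b psi t.
Hypothesis conv : forall j k : nat, pairing_converges w1 w2 'X^j 'X^k.

Let i1 := cintegrable_weight1 t0 conv.
Let i2 := cintegrable_weight2 s0 conv.
Let bl g := pairing_scalarl conv g.
Let br f := pairing_scalarr conv f.
Let m1S := wmean_scalar i1.
Let m2S := wmean_scalar i2.

Lemma pairing_mulX_poly f g :
  pairing w1 w2 ('X * f) g + pairing w1 w2 f ('X * g) = wmean w1 f * wmean w2 g.
Proof.
move: f; apply: scalar_poly_eq => [k p q|k p q|j].
- by rewrite mulrDr -scalerAr !(bl _ k); ring.
- by rewrite m1S; ring.
move: g; apply: scalar_poly_eq => [k p q|k p q|k].
- by rewrite mulrDr -scalerAr !(br _ k); ring.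
- by rewrite m2S; ring.
rewrite -!exprS; apply: (pairing_mulX s0 t0) => // x /andP[_ xs];
  by rewrite weight_neq0 // ltW.
Qed.

(** Both sides are linear in f and in g, so monomials suffice; these are eigenvectors of x d/dx,
    which turns the two derivative terms into the summand j + k of [pairing_euler]. *)
Lemma pairing_euler_poly f g :
  (a + b + 1) * pairing w1 w2 f g + pairing w1 w2 ('X * f^`()) g
  + pairing w1 w2 f ('X * g^`()) =
  wmean w1 f * wmean w2 g
  - xi * cpow s (a + 1) * (expR (- s))%:C * f.[s%:C] * cauchy_transform w2 g (- s%:C)
  - psi * cpow t (b + 1) * (expR (- t))%:C * cauchy_transform w1 f (- t%:C) * g.[t%:C].
Proof.
have XdX (j : nat) : 'X * ('X^j)^`() = j%:R *: 'X^j :> {poly R[i]}.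
  rewrite derivXn mulrnAr; case: j => [|j]; first by rewrite !mulr0n scale0r.
  by rewrite -exprS scaler_nat.
have c1S := cauchy_transform_scalar i1 t0.
have c2S := cauchy_transform_scalar i2 s0.
move: f; apply: scalar_poly_eq => [k p q|k p q|j].
- by rewrite derivD derivZ mulrDr -scalerAr !(bl _ k); ring.
- by rewrite m1S hornerD hornerZ c1S; ring.
move: g; apply: scalar_poly_eq => [k p q|k p q|k].
- by rewrite derivD derivZ mulrDr -scalerAr !(br _ k); ring.
- by rewrite m2S hornerD hornerZ c2S; ring.
rewrite !XdX (scalarZ (bl _)) (scalarZ (br _)) !hornerXn.
have := pairing_euler ha hb s0 t0 conv j k; rewrite -/w1 -/w2 => e.
transitivity ((a + b + 1 + j%:R + k%:R) * pairing w1 w2 'X^j 'X^k); first by ring.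
by rewrite e; ring.
Qed.

End BilinearIdentities.

Theorem proposition4p2 (R : realType) (a b xi psi : R[i])
    (ha : -1 < complex.Re a) (hb : -1 < complex.Re b)
    (s t : R) (hs : 0 < s) (ht : 0 < t)
    (S : nat -> R[i]) (P Q : nat -> {poly R[i]}) :
  let w1 := weight a xi s in
  let w2 := weight b psi t in
  let pi_ n := wmean w1 (P n) in
  let eta n := wmean w2 (Q n) in
  let P1 n := cauchy_transform w1 (P n) in
  let Q1 n := cauchy_transform w2 (Q n) in
  let Ph n := hatP w2 P Q n in
  let Qc n := checkQ w1 P Q n in
  let Ph1 n := cauchy_transform w1 (Ph n) in
  let Qc1 n := cauchy_transform w2 (Qc n) in
  let cs := xi * cpow s (a + 1) * (expR (- s))%:C in
  let ct := psi * cpow t (b + 1) * (expR (- t))%:C in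
  (forall j k : nat, pairing_converges w1 w2 'X^j 'X^k) ->
  (forall n, bimoment_det w1 w2 n != 0) ->
  biorthonormal w1 w2 S P Q ->
  (forall n, pi_ n != 0 /\ eta n != 0) ->
  forall n : nat,
  [/\ forall x : R[i],
        x * (P n)^`().[x] =
          - (n%:R + a + b + 1) * (P n).[x] - pi_ n * (Ph n).[x]
          - cs * (P n).[s%:C] * K01 w2 P Q n x (- s%:C)
          - ct * P1 n (- t%:C) * K00 P Q n x t%:C,
      forall y : R[i],
        y * (Q n)^`().[y] =
          - (n%:R + a + b + 1) * (Q n).[y] - eta n * (Qc n).[y]
          - cs * Q1 n (- s%:C) * K00 P Q n s%:C y
          - ct * (Q n).[t%:C] * K10 w1 P Q n (- t%:C) y,
      forall x : R[i], x != s%:C -> x != - t%:C ->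
        x * (P n)^`().[x] =
          - (n%:R + a + b + 1) * (P n).[x] - pi_ n * (Ph n).[x]
          - cs * ((P n).[s%:C] / (x - s%:C)) *
            ((Qc1 n (- s%:C) - 1) * (Ph n).[x]
             + S n / S n.+1 * Q1 n.+1 (- s%:C) * (P n).[x]
             + S n / S n.+1 * Q1 n (- s%:C) * (P n.+1).[x])
          - ct * (P1 n (- t%:C) / (x + t%:C)) *
            ((Qc n).[t%:C] * (Ph n).[x]
             + S n / S n.+1 * (Q n.+1).[t%:C] * (P n).[x]
             + S n / S n.+1 * (Q n).[t%:C] * (P n.+1).[x])
    & forall y : R[i], y != - s%:C -> y != t%:C ->
        y * (Q n)^`().[y] =
          - (n%:R + a + b + 1) * (Q n).[y] - eta n * (Qc n).[y]
          - cs * (Q1 n (- s%:C) / (s%:C + y)) *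
            ((Ph n).[s%:C] * (Qc n).[y]
             + S n / S n.+1 * (P n.+1).[s%:C] * (Q n).[y]
             + S n / S n.+1 * (P n).[s%:C] * (Q n.+1).[y])
          - ct * ((Q n).[t%:C] / (y - t%:C)) *
            ((Ph1 n (- t%:C) - 1) * (Qc n).[y]
             + S n / S n.+1 * P1 n.+1 (- t%:C) * (Q n).[y]
             + S n / S n.+1 * P1 n (- t%:C) * (Q n.+1).[y])].
Proof.
move=> w1 w2 pi_ eta P1 Q1 Ph Qc Ph1 Qc1 cs ct conv _ [sizePQ leadPQ _ BPQ] _ n.
have sizeP m : size (P m) = m.+1 by have [] := sizePQ m.
have sizeQ m : size (Q m) = m.+1 by have [] := sizePQ m.
have BQP m k : pairing w1 w2 (P k) (Q m) = (m == k)%:R by rewrite BPQ eq_sym.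
have leadQP m : lead_coef (Q m) = S m /\ lead_coef (P m) = S m.
  by have [] := leadPQ m.
have bl := pairing_scalarl conv; have br := pairing_scalarr conv.
have i1 := cintegrable_weight1 ht conv; have i2 := cintegrable_weight2 hs conv.
have eulerE f g := pairing_euler_poly ha hb hs ht conv f g.
have DE f g := pairing_mulX_poly hs ht conv f g.
have first x : x * (P n)^`().[x] =
    - (n%:R + a + b + 1) * (P n).[x] - pi_ n * (Ph n).[x]
    - cs * (P n).[s%:C] * K01 w2 P Q n x (- s%:C)
    - ct * P1 n (- t%:C) * K00 P Q n x t%:C.
  (* The minus sign in the definition of [hatP] turns the plus before the product of means into the
     minus of the statement. *)
  rewrite (biorthogonal_derivative bl br sizeP sizeQ BPQ eulerE) hornerN.
  by rewrite /K01 /K00 /pi_ /cs /ct /P1 /w1 /w2; ring.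
have K10E z y : K10 w1 P Q n z y =
    \sum_(0 <= l < n.+1) (Q l).[y] * cauchy_transform w1 (P l) z.
  by apply: eq_bigr => l _; rewrite mulrC.
have K00E x y : K00 P Q n x y = \sum_(0 <= l < n.+1) (Q l).[y] * (P l).[x].
  by apply: eq_bigr => l _; rewrite mulrC.
have second y : y * (Q n)^`().[y] =
    - (n%:R + a + b + 1) * (Q n).[y] - eta n * (Qc n).[y]
    - cs * Q1 n (- s%:C) * K00 P Q n s%:C y
    - ct * (Q n).[t%:C] * K10 w1 P Q n (- t%:C) y.
  (* The Euler identity for the transposed form: within each jump term the evaluation and the Cauchy
     transform exchange places. *)
  have eulerE' g f : (a + b + 1) * pairing w1 w2 f g + pairing w1 w2 f ('X * g^`())
      + pairing w1 w2 ('X * f^`()) g = wmean w2 g * wmean w1 f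
      - cs * cauchy_transform w2 g (- s%:C) * f.[s%:C]
      - ct * g.[t%:C] * cauchy_transform w1 f (- t%:C).
    by rewrite addrAC eulerE /cs /ct; ring.
  rewrite (biorthogonal_derivative (B := fun g f => pairing w1 w2 f g)
    br bl sizeQ sizeP BQP eulerE') hornerN.
  by rewrite K10E K00E /eta /Q1; ring.
have CD1 x : (x - s%:C) * K01 w2 P Q n x (- s%:C) =
    (Qc1 n (- s%:C) - 1) * (Ph n).[x] + S n / S n.+1 * Q1 n.+1 (- s%:C) * (P n).[x]
    + S n / S n.+1 * Q1 n (- s%:C) * (P n.+1).[x].
  exact: (biorthogonal_Christoffel_Darboux bl br sizeP sizeQ BPQ leadPQ DE
    (cauchy_transform_scalar i2 hs) (fun q => cauchy_transform_mulX i2 q hs)).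
(* Here [lam] is evaluation at y, with [c = 0]. The formula is used at y = t for the P-relation and
   at x = s for the Q-relation. *)
have CD0 x y : (x + y) * K00 P Q n x y =
    (Qc n).[y] * (Ph n).[x] + S n / S n.+1 * (Q n.+1).[y] * (P n).[x]
    + S n / S n.+1 * (Q n).[y] * (P n.+1).[x].
  have evS : scalar (fun q : {poly R[i]} => q.[y]).
    by move=> k p q; rewrite hornerD hornerZ.
  have evX q : ('X * q).[y] = y * q.[y] - 0 * wmean w2 q.
    by rewrite hornerM hornerX mul0r subr0.
  rewrite (biorthogonal_Christoffel_Darboux bl br sizeP sizeQ BPQ leadPQ DE evS evX).
  by rewrite subr0.
(* The transposed counterpart of [CD1], with z = -t and [c = 1]. *)
have CD2 y : (y - t%:C) * K10 w1 P Q n (- t%:C) y =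
    (Ph1 n (- t%:C) - 1) * (Qc n).[y] + S n / S n.+1 * P1 n.+1 (- t%:C) * (Q n).[y]
    + S n / S n.+1 * P1 n (- t%:C) * (Q n.+1).[y].
  have DE' g f : pairing w1 w2 f ('X * g) + pairing w1 w2 ('X * f) g =
      wmean w2 g * wmean w1 f by rewrite addrC DE mulrC.
  rewrite K10E.
  exact: (biorthogonal_Christoffel_Darboux (B := fun g f => pairing w1 w2 f g)
    br bl sizeQ sizeP BQP leadQP DE'
    (cauchy_transform_scalar i1 ht) (fun p => cauchy_transform_mulX i1 p ht)).
split=> // [x xs xt|y ys yt].
- have xs0 : x - s%:C != 0 by rewrite subr_eq0.
  have xt0 : x + t%:C != 0 by rewrite addr_eq0.
  by rewrite first -CD1 -CD0; field; rewrite xs0 xt0.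
- have ys0 : s%:C + y != 0 by rewrite addrC addr_eq0.
  have yt0 : y - t%:C != 0 by rewrite subr_eq0.
  have -> : (Ph n).[s%:C] * (Qc n).[y] + S n / S n.+1 * (P n.+1).[s%:C] * (Q n).[y]
      + S n / S n.+1 * (P n).[s%:C] * (Q n.+1).[y] = (s%:C + y) * K00 P Q n s%:C y.
    by rewrite CD0; ring.
  by rewrite second -CD2; field; rewrite ys0 yt0.
Qed.
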